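(* Let $n\ge0$. Every indecomposable projective $H^n$-module (in the category of finitely generated graded left $H^n$-modules) is isomorphic to $P_a\{m\}$ for some $a\in B^n$ and $m\in\mathbb Z$.
   Context: $G\{k\}$ denotes the shift $G\{k\}_i=G_{i-k}$ of a graded abelian group; tensor products are over $\mathbb Z$. $\mathcal A$ is the free abelian group on $\mathbf 1,X$ with $\deg\mathbf 1=-1$, $\deg X=1$, commutative ring structure with unit $\mathbf 1$ and $X^2=0$; $\iota(1)=\mathbf 1$; $\epsilon(\mathbf 1)=0,\epsilon(X)=1$; $\Delta(\mathbf 1)=\mathbf 1\otimes X+X\otimes\mathbf 1$, $\Delta(X)=X\otimes X$. $\mathcal F$ is the associated two-dimensional TQFT, sending $k$ circles to $\mathcal A^{\otimes k}$ and the merging pair of pants, splitting pair of pants, birth disc, death disc to multiplication, $\Delta$, $\iota$, $\epsilon$. $B^n$ is a set of representatives of isotopy classes of crossingless matchings: embeddings of $n$ disjoint arcs in $\mathbb R\times[0,1]$ pairing the $2n$ points $1,\dots,2n$ on $\mathbb R\times\{1\}$. $W$ is reflection about $\mathbb R\times\{1/2\}$; the concatenation $W(b)a$ ($W(b)$ on top of $a$) is a closed 1-manifold in the plane. $H^n=\bigoplus_{a,b\in B^n}{}_b(H^n)_a$ with ${}_b(H^n)_a=\mathcal F(W(b)a)\{n\}$. The product ${}_d(H^n)_c\otimes{}_b(H^n)_a\to H^n$ is zero if $c\ne b$; ${}_c(H^n)_b\otimes{}_b(H^n)_a\to{}_c(H^n)_a$ is induced via $\mathcal F$ by the cobordism $W(c)bW(b)a\to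 W(c)a$ that is the identity on $W(c)$ and $a$ and is the minimal cobordism ($n$ saddles, diffeomorphic to $n$ discs) from $bW(b)$ to $2n$ vertical segments. This is a graded ring with unit. All $H^n$-modules are graded and homomorphisms are grading-preserving. $P_a=\bigoplus_{b\in B^n}{}_b(H^n)_a$ is the left submodule of $H^n$ associated to $a\in B^n$. A projective $H^n$-module means a projective object of the category of finitely generated graded left $H^n$-modules. *)

(* Defs.v *)
From HB Require Import structures.
From mathcomp Require Import all_boot all_order all_algebra.

Set Implicit Arguments.
Unset Strict Implicit.
Unset Printing Implicit Defensive.

Import GRing.Theory.
Local Open Scope ring_scope.

(* An isotopy class of crossingless matchings is determined by which of the 2n
   boundary points are joined by an arc, so B^n is the set of fixed-point-free
   non-crossing involutions of the 2n points. *)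

Notation point n := 'I_(2 * n).

Definition crossingless n (a : {ffun point n -> point n}) : bool :=
  [forall i, (a i != i) && (a (a i) == i)] &&
  [forall i : point n, forall j : point n, ~~ [&& i < j, j < a i & a i < a j]%N].

Record matching (n : nat) := Matching {
  arc :> {ffun point n -> point n};
  _ : crossingless arc }.

HB.instance Definition _ n := [isSub for @arc n].
HB.instance Definition _ n := [Finite of matching n by <:].

(* A closed 1-manifold cut at a finite set V of points (at least one on each
   circle) into arcs is given by two fixed-point-free involutions f, g of V: each
   point is an endpoint of one f-arc and of one g-arc. Its circles are the
   connected components of the relation [glue f g]. *)
Definition glue (V : finType) (f g : V -> V) : rel V :=
  fun x y => (f x == y) || (g x == y).

(* A basis element of the tensor power of A over the circles labels every circle
   by 1 (false) or X (true). It is recorded as a labelling of the points of V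
   that is constant along arcs. *)
Record state (V : finType) (e : rel V) := State {
  label :> {ffun V -> bool};
  _ : [forall x, forall y, e x y ==> (label x == label y)] }.

HB.instance Definition _ (V : finType) (e : rel V) := [isSub for @label V e].
HB.instance Definition _ (V : finType) (e : rel V) :=
  [Finite of state e by <:].

Lemma stateP (V : finType) (e : rel V) (s : state e) x y :
  e x y -> s x = s y.
Proof. by case: s => /= l lP e_xy; apply/eqP/(implyP (forallP (forallP lP x) y)). Qed.

Notation tqft e := {ffun state e -> int}.

(* deg 1 = -1, deg X = 1, additive over the circles *)
Definition state_degree (V : finType) (e : rel V) (s : state e) : int :=
  (n_comp e [pred x | s x])%:Z - (n_comp e [pred x | ~~ s x])%:Z.

(* coefficient of z in the product x * y in A: 1 is the unit and X^2 = 0 *)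
Definition mul_coef (x y z : bool) : int := (~~ (x && y) && (z == x || y))%:Z.

(* coefficient of y (x) z in Delta x:
   Delta 1 = 1 (x) X + X (x) 1 and Delta X = X (x) X *)
Definition comul_coef (x y z : bool) : int :=
  (if x then y && z else y (+) z)%:Z.

(* Matrix coefficient of the map induced by the saddle from e to e' that trades
   an arc p--q and an arc p'--q' for arcs p--p' and q--q'. If p and p' lie on
   different circles of e, these are merged into the circle of e' through p;
   otherwise their circle is split into the circles of e' through p and q. The
   cobordism is a product on all other circles. *)
Definition saddle_coef (V : finType) (e e' : rel V) (p q p' : V)
    (s : state e) (t : state e') : int :=
  if [forall z, ~~ connect e p z && ~~ connect e p' z ==> (s z == t z)] then
    if connect e p p' then comul_coef (s p) (t p) (t q)
    else mul_coef (s p) (s p') (t p)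
  else 0.

Definition saddle (V : finType) (e e' : rel V) (p q p' : V) (v : tqft e) :
    tqft e' :=
  [ffun t => \sum_s v s * saddle_coef p q p' s t].

Definition W n (b a : matching n) : rel (point n) := glue b a.

Section Product.
Variables (n : nat) (c b a : matching n).

(* W(c) b W(b) a is cut along the 2n common endpoints of W(c) and b (row [true])
   and the 2n common endpoints of W(b) and a (row [false]). S is the set of points
   at which the arcs of b and W(b) have already been replaced by vertical segments
   joining the two rows. *)
Definition outer (z : point n * bool) : point n * bool :=
  ((if z.2 then c z.1 else a z.1), z.2).

Definition inner (S : {set point n}) (z : point n * bool) : point n * bool :=
  if z.1 \in S then (z.1, ~~ z.2) else (b z.1, z.2).

Definition stage (S : {set point n}) : rel (point n * bool) :=
  glue outer (inner S).

Definition surger (S : {set point n}) (i : point n) : {set point n} :=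
  i |: (b i |: S).

Fixpoint saddles (l : seq (point n)) (S : {set point n}) :
    tqft (stage S) -> tqft (stage (foldl surger S l)) :=
  match l with
  | [::] => id
  | i :: l' => fun v =>
      saddles l' (saddle (stage (surger S i)) (i, true) (b i, true) (i, false) v)
  end.

(* The minimal cobordism has one saddle for each arc of b, and the arc is indexed
   by its left endpoint. The n handles are disjoint, so the order in which they
   are attached does not matter. *)
Definition left_endpoints : seq (point n) :=
  [seq i : point n <- enum 'I_(2 * n) | (i < b i)%N].

Lemma upper_subproof (s : state (stage set0)) :
  [forall x, forall y, W c b x y ==>
     ([ffun i => s (i, true)] x == [ffun i => s (i, true)] y)].
Proof.
apply/forallP => x; apply/forallP => y; apply/implyP => e_xy.
rewrite !ffunE; apply/eqP.
apply: stateP.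
by move: e_xy; rewrite /W /stage /glue /outer /inner in_set0 /= !xpair_eqE eqxx !andbT.
Qed.

Lemma lower_subproof (s : state (stage set0)) :
  [forall x, forall y, W b a x y ==>
     ([ffun i => s (i, false)] x == [ffun i => s (i, false)] y)].
Proof.
apply/forallP => x; apply/forallP => y; apply/implyP => e_xy.
rewrite !ffunE; apply/eqP.
apply: stateP.
move: e_xy; rewrite /W /stage /glue /outer /inner in_set0 /= !xpair_eqE eqxx !andbT.
by rewrite orbC.
Qed.

Definition upper (s : state (stage set0)) : state (W c b) :=
  State (upper_subproof s).
Definition lower (s : state (stage set0)) : state (W b a) :=
  State (lower_subproof s).

(* F(W(c)b) (x) F(W(b)a) = F(W(c) b W(b) a) *)
Definition juxtapose (x : tqft (W c b)) (y : tqft (W b a)) : tqft (stage set0) :=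
  [ffun s => x (upper s) * y (lower s)].

Lemma foldl_surgerP (l : seq (point n)) (S : {set point n}) i :
  i \in foldl surger S l = [|| i \in S, i \in l | b i \in l].
Proof.
have bK j : b (b j) = j.
  by case: (b) => f /= /andP[/forallP/(_ j)/andP[_ /eqP]].
elim: l S => [|j l IH] S /=; first by rewrite !orbF.
rewrite IH /surger !inE.
have -> : (b i == j) = (i == b j) by apply/eqP/eqP => [<-|->]; rewrite bK.
by case: (i == j); case: (i == b j); case: (i \in S); rewrite ?orbT ?orbF.
Qed.

Lemma all_surgered i : i \in foldl surger set0 left_endpoints.
Proof.
have [bK bN] : b (b i) = i /\ b i != i.
  by case: (b) => f /= /andP[/forallP/(_ i)/andP[? /eqP]].
have E j : (j \in left_endpoints) = (j < b j)%N.
  by rewrite mem_filter mem_enum andbT.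
rewrite foldl_surgerP !E bK in_set0 /=.
by rewrite -neq_ltn eq_sym.
Qed.

Lemma vertical_subproof (t : state (W c a)) :
  let e := stage (foldl surger set0 left_endpoints) in
  [forall x, forall y, e x y ==>
     ([ffun z : point n * bool => t z.1] x == [ffun z => t z.1] y)].
Proof.
rewrite /=; apply/forallP => -[x r]; apply/forallP => -[y r'].
rewrite !ffunE; apply/implyP; rewrite /stage /glue /outer /inner /=.
rewrite all_surgered !xpair_eqE => /orP[/andP[xy _]|/andP[/eqP-> _] //].
apply/eqP; apply: stateP; rewrite /W /glue.
by case: r xy => ->; rewrite ?orbT.
Qed.

(* Shrinking the 2n vertical segments gives W(c)a. *)
Definition vertical (t : state (W c a)) :
    state (stage (foldl surger set0 left_endpoints)) :=
  State (vertical_subproof t).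

Definition mult (x : tqft (W c b)) (y : tqft (W b a)) : tqft (W c a) :=
  [ffun t => saddles left_endpoints (juxtapose x y) (vertical t)].

Lemma saddles0 l S : saddles l (0 : tqft (stage S)) = 0.
Proof.
elim: l S => //= i l IH S; rewrite -[RHS](IH (surger S i)); congr saddles.
by apply/ffunP => t; rewrite !ffunE big1 // => s _; rewrite ffunE mul0r.
Qed.

Lemma mult_0r x : mult x 0 = 0.
Proof.
have E : juxtapose x 0 = 0 by apply/ffunP => s; rewrite !ffunE mulr0.
by apply/ffunP => t; rewrite !ffunE E saddles0 ffunE.
Qed.

End Product.

(* triples (b, a, s) with s a basis element of F(W(b)a) *)
Notation basis n := {ba : matching n * matching n & state (W ba.1 ba.2)}.

Definition H (n : nat) : Type := {ffun basis n -> int}.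
HB.instance Definition _ n := GRing.Zmodule.on (H n).

Section Ring.
Variable n : nat.
Implicit Types (x y : H n) (a b c : matching n).

Definition block x b a : tqft (W b a) :=
  [ffun s => x (existT (fun ba => state (W ba.1 ba.2)) (b, a) s)].

Definition H_mul x y : H n :=
  [ffun u : basis n =>
     (\sum_b mult (block x (tag u).1 b) (block y b (tag u).2)) (tagged u)].

(* The unit is the sum over a of iota^{(x) n}(1) in F(W(a)a). *)
Definition H_one : H n :=
  [ffun u : basis n =>
     (((tag u).1 == (tag u).2) && [forall i, ~~ tagged u i])%:Z].

(* the summand + n comes from the shift {n} *)
Definition H_homog (i : int) x : Prop :=
  forall u : basis n, x u != 0 -> state_degree (tagged u) + n%:Z = i.

End Ring.

(* Bare data of a graded left H^n-module, subject to the axioms [graded_module]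
   below: [mhomog M i x] says that x lies in the degree i component of M, and M is
   the internal direct sum of these components. *)
Record hact (n : nat) := HAct {
  carrier :> zmodType;
  act : H n -> carrier -> carrier;
  mhomog : int -> carrier -> Prop }.

Record graded_module (n : nat) (M : hact n) : Prop := GradedModule {
  act_addl : forall (h k : H n) (x : M), act (h + k) x = act h x + act k x;
  act_addr : forall (h : H n) (x y : M), act h (x + y) = act h x + act h y;
  act_one : forall x : M, act (H_one n) x = x;
  act_mul : forall (h k : H n) (x : M), act (H_mul h k) x = act h (act k x);
  mhomog0 : forall i, mhomog i (0 : M);
  mhomogB : forall i (x y : M), mhomog i x -> mhomog i y -> mhomog i (x - y);
  mhomog_act : forall i j (h : H n) (x : M),
    H_homog i h -> mhomog j x -> mhomog (i + j) (act h x);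
  mhomog_span : forall x : M, exists (r : seq int) (f : int -> M),
    (forall i, mhomog i (f i)) /\ x = \sum_(i <- r) f i;
  mhomog_free : forall (r : seq int) (f : int -> M),
    uniq r -> (forall i, mhomog i (f i)) -> \sum_(i <- r) f i = 0 ->
    forall i, i \in r -> f i = 0 }.

Definition finitely_generated (n : nat) (M : hact n) : Prop :=
  exists (k : nat) (g : 'I_k -> M), forall x : M, exists h : 'I_k -> H n,
    x = \sum_(i < k) act (h i) (g i).

Record fgmod (n : nat) := FgMod {
  fgmod_hact :> hact n;
  fgmod_graded : graded_module fgmod_hact;
  fgmod_fg : finitely_generated fgmod_hact }.

Record ghom (n : nat) (M N : hact n) := GHom {
  ghom_fun :> {additive M -> N};
  ghom_act : forall (h : H n) (x : M), ghom_fun (act h x) = act h (ghom_fun x);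
  ghom_homog : forall i (x : M), mhomog i x -> mhomog i (ghom_fun x) }.

Definition isomorphic (n : nat) (M N : hact n) : Prop :=
  exists (f : ghom M N) (g : ghom N M), cancel f g /\ cancel g f.

Definition epimorphism (n : nat) (M N : fgmod n) (g : ghom M N) : Prop :=
  forall (L : fgmod n) (u v : ghom N L),
    (forall x, u (g x) = v (g x)) -> forall y, u y = v y.

Definition projective (n : nat) (P : fgmod n) : Prop :=
  forall (M N : fgmod n) (g : ghom M N) (f : ghom P N),
    epimorphism g -> exists f' : ghom P M, forall x, g (f' x) = f x.

Definition dsum (n : nat) (M N : hact n) : hact n :=
  @HAct n (M * N)%type
    (fun h x => (act h x.1, act h x.2))
    (fun i x => mhomog i x.1 /\ mhomog i x.2).

Definition is_zero (n : nat) (M : hact n) : Prop := forall x : M, x = 0.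

Definition indecomposable (n : nat) (M : fgmod n) : Prop :=
  ~ is_zero M /\
  forall N1 N2 : fgmod n, isomorphic M (dsum N1 N2) -> is_zero N1 \/ is_zero N2.

(* M{m}_i = M_{i - m} *)
Definition shift (n : nat) (m : int) (M : hact n) : hact n :=
  @HAct n M (@act n M) (fun i x => mhomog (i - m) x).

(* P_a consists of the elements of H^n whose component at (b, a') vanishes
   unless a' = a; action and grading are those of H^n. *)
Definition in_proj (n : nat) (a : matching n) : {pred H n} :=
  [pred x : H n | [forall u : basis n, ((tag u).2 != a) ==> (x u == 0)]].

Lemma in_projP (n : nat) (a : matching n) (x : H n) :
  reflect (forall u : basis n, (tag u).2 != a -> x u = 0) (x \in in_proj a).
Proof.
apply: (iffP forallP) => xP u; first by move=> ua; apply/eqP/(implyP (xP u)).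
by apply/implyP => /xP->.
Qed.

Lemma in_proj_zmod_closed n (a : matching n) : zmod_closed (in_proj a).
Proof.
split=> [|x y /in_projP xP /in_projP yP].
  by apply/in_projP => u _; rewrite ffunE.
by apply/in_projP => u ua; rewrite !ffunE xP // yP // subr0.
Qed.

HB.instance Definition _ n (a : matching n) :=
  GRing.isZmodClosed.Build (H n) (in_proj a) (in_proj_zmod_closed a).

Record proj_car (n : nat) (a : matching n) := ProjCar {
  proj_val :> H n;
  proj_valP : proj_val \in in_proj a }.

HB.instance Definition _ n (a : matching n) := [isSub for @proj_val n a].
HB.instance Definition _ n (a : matching n) := [Choice of proj_car a by <:].
HB.instance Definition _ n (a : matching n) :=
  [SubChoice_isSubZmodule of proj_car a by <:].

Lemma in_proj_mul n (a : matching n) (h x : H n) :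
  x \in in_proj a -> H_mul h x \in in_proj a.
Proof.
move=> /in_projP xP; apply/in_projP => u ua; rewrite ffunE big1 ?ffunE //.
move=> b _; rewrite -[RHS](mult_0r (tag u).2 (block h (tag u).1 b)); congr mult.
by apply/ffunP => s; rewrite !ffunE xP.
Qed.

Definition proj_act n (a : matching n) (h : H n) (x : proj_car a) : proj_car a :=
  ProjCar (in_proj_mul h (proj_valP x)).

Definition proj (n : nat) (a : matching n) : hact n :=
  @HAct n (proj_car a) (@proj_act n a) (fun i x => H_homog i (proj_val x)).

(* Main.v *)
From HB Require Import structures.
From Stdlib Require Import Classical.
Require Import Defs.
From mathcomp Require Import all_boot all_order fingroup perm all_algebra zify.

(* A saddle is linear over Z[X_v], the X_v acting on F(e) as multiplication by X on
   the circle through v; it sends 1 to 1 if it merges two circles and to X_p + X_q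
   if it splits one. Hence the product of H^n is determined by the products of the
   units of F(W(c)b) and F(W(b)a), which are products of such sums X_p + X_q. Two
   disjoint saddles commute, and this gives associativity; counting circles shows
   that the product is graded and that H^n is nonnegatively graded, with degree 0
   part the product of the rings Z 1_a.

   Let M be an indecomposable projective. It embeds as a direct summand in a finite
   free graded module. Take a coordinate of lowest degree m that does not vanish on
   M, at a basis element in the row of a, and divide it by the generator of its
   image: this is a surjection from M to the module Z, shifted by m, on which H^n acts
   through the coefficient of 1_a. It lifts to psi : M -> P_a{m}. An element y of
   degree m mapped to 1 in Z satisfies psi y = 1_a, so h |-> h y is a section of psi,
   P_a{m} is a direct summand of M, and M is isomorphic to it. *)

Set Implicit Arguments.
Unset Strict Implicit.
Unset Printing Implicit Defensive.

Import Order.POrderTheory Order.TotalTheory GRing.Theory Num.Theory.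
Local Open Scope ring_scope.

(** * Surgery on pairs of involutions *)

(** Planarity enters through parity. Two glued involutions describe abstract curves, and trading two
    arcs of such curves may leave the number of circles unchanged; a saddle would then be neither a
    merge nor a split. Since arcs do not cross, each joins points of opposite parity. This orients
    every diagram used here, and a surgery that respects the orientation changes the number of
    circles by exactly one.

    The product is a composite of saddles in a fixed order, through spaces of different dependent
    types. Composites are therefore not compared on states: a composite is recorded as a list of
    pairs (p, q), and two lists are compared by their effect on words in the X_v. The two
    bracketings of a triple product become two orders of the same saddles on one diagram with three
    rows.

    Over Z the image of a coordinate can be a proper ideal, hence the division by a generator. The
    lowest degree is what makes a coordinate compatible with the action: only the degree 0 part of a
    ring element can contribute to it. *)

Lemma fconnect_porbit (T : finType) (s : {perm T}) x y :
  fconnect s x y = (y \in porbit s x).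
Proof.
apply/idP/porbitP => [/iter_findex <-|[i ->]]; last by rewrite permX fconnect_iter.
by exists (findex s x y); rewrite permX.
Qed.

Section Surgery.
Variable V : finType.
Implicit Types (e c : rel V) (f g : V -> V).

(** One relation serves both kinds of saddle, since a split is a merge read backwards. *)
Definition joins c c' (p q : V) : Prop :=
  ~~ c p q /\
  forall x y, c' x y = [|| c x y, c x p && c q y | c x q && c p y].

(* A saddle from e to e' that trades arcs p--q and p'--q' for p--p' and q--q': it
   splits a circle if p and p' lie on the same one, and otherwise merges the
   circles of p and p'. *)
Definition step e e' (p q p' : V) : Prop :=
  [/\ connect_sym e, connect_sym e', connect e p q, connect e' p p' &
      if connect e p p' then joins (connect e') (connect e) p q
      else joins (connect e) (connect e') p p'].

(** All four ends lie on one circle of [e'], so a path of [e] survives in [e'] even through the two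
    removed arcs. The roles of [e] and [e'] can be exchanged, because the inverse surgery has the
    same shape. *)
Lemma joins_surgery e e' p q p' q' :
    connect_sym e -> connect_sym e' ->
    connect e p q -> connect e p' q' -> connect e' p p' -> connect e' q q' ->
    (forall x y, e x y -> connect e' x y \/
       (x, y) \in [:: (p, q); (q, p); (p', q'); (q', p')]) ->
    (forall x y, e' x y -> connect e x y \/
       (x, y) \in [:: (p, p'); (p', p); (q, q'); (q', q)]) ->
    connect e' p q -> ~~ connect e p p' ->
  joins (connect e) (connect e') p p'.
Proof.
move=> se se' epq epq' e'pp e'qq ee' e'e e'pq nepp; split=> // x y.
have tr := @connect_trans _ e; have tr' := @connect_trans _ e'.
have sub : subrel (connect e) (connect e').
  apply: connect_sub => u v /ee'[//|]; rewrite !inE !xpair_eqE.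
  case/or4P=> /andP[/eqP-> /eqP->] //; first by rewrite se'.
    by apply: (tr' p); [rewrite se'|apply: (tr' q)].
  by rewrite se'; apply: (tr' p); [rewrite se'|apply: (tr' q)].
apply/idP/idP; last first.
  case/or3P=> [/sub //|/andP[/sub xp /sub py]|/andP[/sub xp /sub py]].
    by apply: (tr' p) => //; apply: (tr' p').
  by apply: (tr' p') => //; apply: (tr' p) => //; rewrite se'.
(* The class of [x] predicted by the formula; it suffices that no edge of [e'] leaves it. *)
pose A := [pred z | [|| connect e x z, connect e x p && connect e p' z
                                     | connect e x p' && connect e p z]].
have clA : closed e' A.
  apply: intro_closed => // u v uv; rewrite !inE.
  have [euv|] := e'e _ _ uv.
    by case/or3P=> [h|/andP[-> h]|/andP[-> h]]; rewrite (tr _ _ _ h euv) ?orbT.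
  have sy a b : connect e a b = connect e b a by exact: se.
  have pq z : connect e z q = connect e z p.
    by apply/idP/idP => h; apply: tr h _ => //; rewrite sy.
  have pq' z : connect e z q' = connect e z p'.
    by apply/idP/idP => h; apply: tr h _ => //; rewrite sy.
  rewrite !inE !xpair_eqE.
  case/or4P=> /andP[/eqP-> /eqP->]; rewrite ?pq ?pq' ?(negPf nepp)
    ?[connect e p' p]sy ?(negPf nepp) ?connect0 ?andbT ?andbF ?orbF;
    by do 2?case: (connect e x _).
move=> e'xy; have := closed_connect clA e'xy.
by rewrite !inE connect0 /= => <-.
Qed.

Lemma glue_sym f g : involutive f -> involutive g -> connect_sym (glue f g).
Proof.
move=> fK gK; apply: sym_connect_sym => x y; rewrite /glue.
by congr orb; apply/eqP/eqP => <-.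
Qed.

Lemma connect_gluel f g x : connect (glue f g) x (f x).
Proof. by rewrite connect1 // /glue eqxx. Qed.

Lemma connect_gluer f g x : connect (glue f g) x (g x).
Proof. by rewrite connect1 // /glue eqxx orbT. Qed.

Section Orientation.
Variables (f g : V -> V) (sgn : V -> bool).
Hypotheses (fK : involutive f) (gK : involutive g).
Hypotheses (fS : forall v, sgn (f v) = ~~ sgn v) (gS : forall v, sgn (g v) = ~~ sgn v).

(* On the points of sign b, following an arc of g and then an arc of f is a
   permutation whose orbits are the circles. *)
Definition turn (b : bool) (v : V) : V := if sgn v == b then f (g v) else v.

Lemma turn_inj b : injective (turn b).
Proof.
apply: (can_inj (g := fun v => if sgn v == b then g (f v) else v)) => v.
rewrite /turn.
by case sv: (sgn v == b); rewrite ?fS ?gS ?negbK sv ?fK ?gK.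
Qed.

Lemma connect_turn b x y : sgn x = b -> sgn y = b ->
  connect (glue f g) x y = (y \in porbit (perm (@turn_inj b)) x).
Proof.
move=> sx sy; rewrite -fconnect_porbit.
apply/idP/idP; last first.
  have : subrel (connect (frel (perm (@turn_inj b)))) (connect (glue f g)).
    apply: connect_sub => u v /eqP<-; rewrite permE /turn; case: ifP => // _.
    exact: connect_trans (connect_gluer f g u) (connect_gluel f g _).
  exact.
set s := perm _.
(* A point of the other sign is filed under [f z], which lies in the same orbit as [g z]; so both
   kinds of arcs preserve [A]. *)
pose A := [pred z | if sgn z == b then fconnect s x z else fconnect s x (f z)].
have symA u v : glue f g u v -> u \in A -> v \in A.
  have sE z : sgn z = b -> s z = f (g z) by rewrite permE /turn => ->; rewrite eqxx.
  have nb (a1 b1 : bool) : (~~ a1 == b1) = ~~ (a1 == b1) by case: a1; case: b1.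
  case/orP=> /eqP<-; rewrite !inE ?fS ?gS nb if_neg.
    by rewrite fK; case: ifP.
  case: ifP => su h; first by apply: connect_trans h _; rewrite -sE ?(eqP su) // fconnect1.
  apply: connect_trans h _; rewrite fconnect_sym; last exact: perm_inj.
  by have := fconnect1 s (g u); rewrite sE ?gK // gS; apply/eqP; rewrite nb su.
have clA : closed (glue f g) A by apply: intro_closed symA; apply: glue_sym.
move=> /(closed_connect clA).
by rewrite !inE sx sy eqxx connect0 => <-.
Qed.

End Orientation.

(* The permutations [turn] before and after the surgery differ by the transposition
   of p and g p', so their numbers of orbits differ by one. *)
Lemma surgery_xor f g g' sgn p p' :
    involutive f -> involutive g -> involutive g' ->
    (forall v, sgn (f v) = ~~ sgn v) -> (forall v, sgn (g v) = ~~ sgn v) ->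
    sgn p' = ~~ sgn p -> p' != g p ->
    (forall z, g' z = if z == p then p' else if z == p' then p
       else if z == g p then g p' else if z == g p' then g p else g z) ->
  connect (glue f g) p p' = ~~ connect (glue f g') p (g p).
Proof.
move=> fK gK g'K fS gS sp' np' g'E.
have g'S v : sgn (g' v) = ~~ sgn v.
  rewrite g'E; have [->|_] := eqVneq v p; first by rewrite sp'.
  have [->|_] := eqVneq v p'; first by rewrite sp' negbK.
  have [->|_] := eqVneq v (g p); first by rewrite !gS sp'.
  by have [->|_] := eqVneq v (g p'); rewrite ?gS ?sp' ?negbK.
have npp : p != p' by apply/eqP => pp; move: sp'; rewrite -pp; case: (sgn p).
have nq : g p != p by apply/eqP => E; move: (gS p); rewrite E; case: (sgn p).
have nq' : g p' != p' by apply/eqP => E; move: (gS p'); rewrite E; case: (sgn p').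
have nqq : g p' != g p by rewrite (can_eq gK) eq_sym.
have npq' : g p' != p by apply: contra np' => /eqP <-; rewrite gK.
have g'q : g' (g p) = g p'.
  by rewrite g'E (negPf nq) eq_sym (negPf np') eqxx.
have sq' : sgn (g p') = sgn p by rewrite gS sp' negbK.
(* [connect_turn] compares points of equal sign, so [p'] and [g p] are both replaced by [g p'], the
   far end of an arc that starts there. *)
have cq : connect (glue f g) p p' = connect (glue f g) p (g p').
  apply/idP/idP => h; first exact: connect_trans h (connect_gluer _ _ _).
  by apply: connect_trans h _; rewrite -{2}[p']gK; exact: connect_gluer.
have cq' : connect (glue f g') p (g p) = connect (glue f g') p (g p').
  rewrite -g'q; apply/idP/idP => h; first exact: connect_trans h (connect_gluer _ _ _).
  by apply: connect_trans h _; rewrite -{2}[g p]g'K; exact: connect_gluer.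
rewrite cq cq' (connect_turn fK gK fS gS (b := sgn p)) //.
rewrite (connect_turn fK g'K fS g'S (b := sgn p)) //.
set s := perm _; set s' := perm _; set q' := g p' in nq' nqq npq' sq' g'q *.
have s'E : s' = (tperm p q' * s)%g.
  apply/permP => z; rewrite permM.
  case: (tpermP p q' z) => [->|->|/eqP zp /eqP zq']; rewrite !permE /turn g'E.
  - by rewrite sq' !eqxx /q' gK.
  - by rewrite sq' eqxx (negPf npq') (negPf nq') (negPf nqq) eqxx.
  rewrite (negPf zp) (negPf zq'); case: eqP => // sz.
  case: eqP => [zE|_]; first by move: sz; rewrite zE sp'; case: (sgn p).
  by case: eqP => // zE; move: sz; rewrite zE gS; case: (sgn p).
have sE : s = (tperm p q' * s')%g by rewrite s'E mulgA tperm2 mul1g.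
(* Multiplication by the transposition leads from [s] to [s'] and back, with opposite changes of the
   orbit count; hence [q'] lies in the orbit of [p] for exactly one of the two. *)
have := porbits_mul_tperm s p q'; have := porbits_mul_tperm s' p q'.
rewrite /= -s'E -sE (eq_sym p) npq' (porbit_sym s p) (porbit_sym s' p).
case: (q' \in _) (q' \in _) => -[]; move: #|_| #|_| => a b; clear; rewrite /=; lia.
Qed.

(** [surgery_xor] decides between merge and split; the split is [joins_surgery] applied to the
    inverse surgery. *)
Lemma surgery_step f g g' sgn p p' :
    involutive f -> involutive g -> involutive g' ->
    (forall v, sgn (f v) = ~~ sgn v) -> (forall v, sgn (g v) = ~~ sgn v) ->
    sgn p' = ~~ sgn p -> p' != g p ->
    (forall z, g' z = if z == p then p' else if z == p' then p
       else if z == g p then g p' else if z == g p' then g p else g z) ->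
  step (glue f g) (glue f g') p (g p) p'.
Proof.
move=> fK gK g'K fS gS sp' np' g'E.
have xor := surgery_xor fK gK g'K fS gS sp' np' g'E.
have se := glue_sym fK gK; have se' := glue_sym fK g'K.
have nq : g p != p by apply/eqP => E; move: (gS p); rewrite E; case: (sgn p).
have e'pp : connect (glue f g') p p'.
  by have := connect_gluer f g' p; rewrite g'E eqxx.
have epq := connect_gluer f g p; have epq' := connect_gluer f g p'.
have e'qq : connect (glue f g') (g p) (g p').
  by have := connect_gluer f g' (g p); rewrite g'E (negPf nq) eq_sym (negPf np') eqxx.
have ee' x y : glue f g x y -> connect (glue f g') x y \/
       (x, y) \in [:: (p, g p); (g p, p); (p', g p'); (g p', p')].
  case/orP=> /eqP<-; first by left; exact: connect_gluel.
  rewrite !inE !xpair_eqE.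
  have [->|xp] := eqVneq x p; first by rewrite eqxx; right.
  have [->|xp'] := eqVneq x p'; first by rewrite eqxx !orbT; right.
  have [->|xq] := eqVneq x (g p); first by rewrite gK eqxx !orbT; right.
  have [->|xq'] := eqVneq x (g p'); first by rewrite gK eqxx !orbT; right.
  have := connect_gluer f g' x; rewrite g'E.
  by rewrite (negPf xp) (negPf xp') (negPf xq) (negPf xq'); left.
have e'e x y : glue f g' x y -> connect (glue f g) x y \/
       (x, y) \in [:: (p, p'); (p', p); (g p, g p'); (g p', g p)].
  case/orP=> /eqP<-; first by left; exact: connect_gluel.
  rewrite !inE !xpair_eqE g'E.
  have [->|xp] := eqVneq x p; first by rewrite eqxx; right.
  have [->|xp'] := eqVneq x p'; first by rewrite eqxx !orbT; right.
  have [->|xq] := eqVneq x (g p); first by rewrite eqxx !orbT; right.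
  have [->|xq'] := eqVneq x (g p'); first by rewrite eqxx !orbT; right.
  by left; exact: connect_gluer.
split=> //; case: ifPn => [cpp|ncpp].
  by apply: (@joins_surgery _ _ p p' (g p) (g p')); rewrite -?xor.
by apply: (@joins_surgery _ _ p (g p) p' (g p')); move: ncpp; rewrite // xor negbK.
Qed.

(** The union [A] of the circles of [p] and [q] is two components of [e] and one of [e']. Off [A]
    the two relations have the same classes, hence the same chosen roots. *)
Lemma joins_n_comp e e' p q :
    connect_sym e -> connect_sym e' -> joins (connect e) (connect e') p q ->
  n_comp e predT = (n_comp e' predT).+1.
Proof.
move=> se se' [npq cE].
have sy a b : connect e a b = connect e b a by exact: se.
pose A := [pred z | connect e p z || connect e q z].
have c'p : connect e' p =1 A.
  move=> z; rewrite !inE; move: (cE p z); rewrite connect0 (negPf npq) orbF => <-.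
  by [].
have clA : A =i closure e (pred2 p q).
  move=> z; apply/orP/pred0Pn => [|[y /andP[/= zy /pred2P]]]; last first.
    by rewrite -!(sy z); case=> <-; [left|right].
  by rewrite -!(sy z) => -[zp|zq]; [exists p|exists q];
    apply/andP; split=> //; rewrite !inE eqxx ?orbT.
rewrite (n_compC A e) (n_compC (connect e' p) e') n_comp_connect //.
rewrite (eq_n_comp_r clA) n_comp_closure2 // (negPf npq) !add1n add2n /n_comp_mem.
congr _.+2; apply: eq_card => z; rewrite !inE c'p !inE.
apply: andb_id2r => /norP[npz nqz]; rewrite /roots /root.
congr (odflt z _ == z); apply: eq_pick => y.
by rewrite cE (sy z p) (sy z q) (negPf npz) (negPf nqz) orbF.
Qed.

End Surgery.

(** * Saddles *)

Section Monomials.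
Variable V : finType.
Implicit Types (e : rel V) (w : seq V) (L : seq (V * V)) (t : V -> bool).

(* F(e) is the quotient of Z[X_v : v in V] by X_v^2 = 0 and by X_v = X_w for v, w
   on a common circle; the saddles are linear over Z[X_v], merging sends 1 to 1
   and splitting sends 1 to X_p + X_q. [mon e w] is the monomial prod_(v <- w) X_v
   in the basis of states, and [ev e L w] is its product with
   prod_((p, q) <- L) (X_p + X_q). *)
Definition mon e w t : int := [forall z, count (connect e z) w == t z]%:Z.

Fixpoint ev e L w t : int :=
  if L is pq :: L' then ev e L' (pq.1 :: w) t + ev e L' (pq.2 :: w) t
  else mon e w t.

(** Equality in F(e) of the products of the sums X_p + X_q over the two lists. Here [t] is any
    function rather than a state, which avoids dependent types when diagrams are compared; by
    [ev_const] both sides vanish where [t] is not constant on circles. *)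
Definition eqv e L L' := forall w t, ev e L w t = ev e L' w t.

(** The factor contributed by one saddle: X_p + X_q for a split, and the empty product 1 for a
    merge. *)
Definition cut e (p q p' : V) := if connect e p p' then [:: (p, q)] else [::].

Lemma mon_perm e w w' t : perm_eq w w' -> mon e w t = mon e w' t.
Proof.
by move=> /seq.permP ww; congr (nat_of_bool _)%:Z; apply: eq_forallb => z; rewrite ww.
Qed.

Lemma ev_perm e L w w' t : perm_eq w w' -> ev e L w t = ev e L w' t.
Proof.
elim: L w w' => [|pq L IH] w w' ww /=; first exact: mon_perm.
by congr +%R; apply: IH; rewrite perm_cons.
Qed.

Lemma eqv_catl e N L L' : eqv e L L' -> eqv e (N ++ L) (N ++ L').
Proof.
by move=> LL; elim: N => [|pq N IH] w t //=; rewrite !IH.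
Qed.

Lemma mon_const e w t x y : connect_sym e -> mon e w t != 0 ->
  connect e x y -> t x = t y.
Proof.
rewrite /mon => se; case: forallP => // wt _ xy.
have := wt x; rewrite (eq_count (same_connect se xy)) (eqP (wt y)).
by case: (t x) (t y) => -[].
Qed.

Lemma ev_const e L w t x y : connect_sym e -> ev e L w t != 0 ->
  connect e x y -> t x = t y.
Proof.
move=> se; elim: L w => [|pq L IH] w /=; first exact: mon_const.
have [->|/IH h _ //] := eqVneq (ev e L (pq.1 :: w) t) 0.
by rewrite add0r; exact: IH.
Qed.

Lemma state_connect e (s : state e) x y : connect e x y -> s x = s y.
Proof.
move=> xy; have cl : closed e [pred z | s z] by move=> u v /(stateP s); rewrite !inE.
by have := closed_connect cl xy; rewrite !inE.
Qed.

Lemma support_subproof e (se : connect_sym e) w : [forall x, forall y, e x y ==>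
  ([ffun z => has (connect e z) w] x == [ffun z => has (connect e z) w] y)].
Proof.
apply/forallP=> x; apply/forallP=> y; apply/implyP=> /connect1 xy.
by rewrite !ffunE; apply/eqP/eq_has/(same_connect se xy).
Qed.

Definition support e (se : connect_sym e) w : state e := State (support_subproof se w).

(** Two letters on one circle give X^2 = 0; any other word is a single basis state, its
    [support]. *)
Lemma sum_mon e (se : connect_sym e) w (F : state e -> int) :
  \sum_(s : state e) mon e w s * F s =
  if [forall z, count (connect e z) w <= 1]%N then F (support se w) else 0.
Proof.
case: ifPn => [/forallP le1|/forallPn[z]]; last first.
  rewrite -ltnNge => gt1; rewrite big1 // => s _.
  rewrite /mon; case: forallP => [/(_ z)/eqP wE|]; last by rewrite mul0r.
  by move: gt1; rewrite wE; case: (s z).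
rewrite (bigD1 (support se w)) //= big1 ?addr0 => [|s ns].
  rewrite /mon; case: forallP => [|[]]; rewrite ?mul1r // => z.
  by rewrite ffunE has_count; case: (count _ _) (le1 z) => [|[]].
rewrite /mon; case: forallP => [wE|]; last by rewrite mul0r.
case/eqP: ns; apply/val_inj/ffunP => z; rewrite ffunE has_count (eqP (wE z)).
by case: (s z).
Qed.

Lemma joins_sub (c c' : rel V) p q x y : joins c c' p q -> c x y -> c' x y.
Proof. by case=> _ cE xy; rewrite cE xy. Qed.

(** Circles away from [p] and [p'] carry the same letters before and after. What remains is a
    comparison with the tables of comultiplication and multiplication, where the letters on each
    circle concerned number 0, 1 or more. *)
Lemma saddle_mon e e' p q p' w : step e e' p q p' ->
  saddle e' p q p' [ffun s : state e => mon e w s] =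
  [ffun t : state e' => ev e' (cut e p q p') w t].
Proof.
move=> [se se' epq e'pp J]; apply/ffunP => t; rewrite !ffunE.
under eq_bigr do rewrite ffunE.
rewrite (sum_mon se w (fun s => saddle_coef p q p' s t)).
have sy a b : connect e a b = connect e b a by exact: se.
have sy' a b : connect e' a b = connect e' b a by exact: se'.
have nE x y : connect e x y -> count (connect e x) w = count (connect e y) w.
  by move=> xy; apply/eq_count/(same_connect se xy).
have n'E x y : connect e' x y -> count (connect e' x) w = count (connect e' y) w.
  by move=> xy; apply/eq_count/(same_connect se' xy).
pose off z := ~~ connect e p z && ~~ connect e p' z.
rewrite /cut /saddle_coef; move: J; case: ifPn => [epp [npq cE]|nepp [_ cE]] /=.
- have offn z : ~~ connect e p z -> count (connect e' z) w = count (connect e z) w.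
    move=> nz; apply: eq_count => y; rewrite cE.
    have /negPf-> : ~~ connect e' z p.
      by apply: contra nz; rewrite sy cE => ->.
    have /negPf-> : ~~ connect e' z q.
      apply: contra nz => zq; rewrite sy cE zq connect0 andbT.
      by rewrite !orbT.
    by rewrite !andFb !orbF.
  have np : count (connect e p) w = (count (connect e' p) w + count (connect e' q) w)%N.
    rewrite -count_predUI [X in (_ + X)%N](_ : _ = 0%N) ?addn0.
      apply: eq_count => y /=; rewrite cE connect0 (negPf npq) /= orbF.
      by [].
    apply/eqP; rewrite -leqn0 leqNgt -has_count; apply/hasPn => y _ /=.
    by apply: contra npq => /andP[py qy]; rewrite (same_connect se' py) sy'.
  have offE r : connect e p r -> ((r == p) || (r == q)) ->
      [forall z, count (connect e' z) (r :: w) == t z] =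
      [&& [forall z, off z ==> (count (connect e z) w == t z)],
          (r == p) + count (connect e' p) w == t p &
          (r == q) + count (connect e' q) w == t q]%N.
    move=> pr rpq.
    have rp : connect e' p r = (r == p).
      case/orP: rpq => /eqP->; first by rewrite connect0 eqxx.
      by rewrite (negPf npq); apply/esym/eqP => E; rewrite E connect0 in npq.
    have rq : connect e' q r = (r == q).
      case/orP: rpq => /eqP->; last by rewrite connect0 eqxx.
      by rewrite sy' (negPf npq); apply/esym/eqP => E; rewrite E connect0 in npq.
    apply/forallP/and3P => [h|[/forallP h hp hq] z].
      split; [|by have := h p; rewrite /= rp|by have := h q; rewrite /= rq].
      apply/forallP => z; apply/implyP => /andP[nz _]; have := h z.
      rewrite /= offn // (_ : connect e' z r = false) //.
      apply/negP => zr; case/negP: nz; apply: connect_trans pr _.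
      by rewrite sy cE zr.
    rewrite /=; have [pz|nz] := boolP (connect e p z); last first.
      have := h z; rewrite /off nz -(same_connect se epp) nz /= offn //.
      rewrite (_ : connect e' z r = false) //.
      apply/negP => zr; case/negP: nz; apply: connect_trans pr _.
      by rewrite sy cE zr.
    move: pz; rewrite cE connect0 (negPf npq) /= orbF => /orP[] yz.
      by rewrite -(same_connect se' yz) rp -(n'E _ _ yz) -(state_connect t yz).
    by rewrite -(same_connect se' yz) rq -(n'E _ _ yz) -(state_connect t yz).
  rewrite /mon !offE ?connect0 ?eqxx ?orbT // (eq_sym q).
  have /negPf-> : p != q by apply: contraNneq npq => ->; rewrite connect0.
  (* A word that is zero in F(e) must stay zero. If the circle with two letters is the one that
     splits, the factor X_p + X_q adds a third, and one of the two new circles receives at least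
     two. *)
  have [/forallP le1|/forallPn[z]] := boolP [forall z, (count (connect e z) w <= 1)%N]; last first.
    rewrite -ltnNge => gt1; case: forallP => //= h.
    have [pz|nz] := boolP (connect e p z).
      move: gt1; rewrite -(nE _ _ pz) np.
      by move: (count _ _) (count _ _) (t p) (t q) => [|[|a]] [|[|b]] [] [].
    have := h z; rewrite /off nz -(same_connect se epp) nz /= => /eqP zE.
    by move: gt1; rewrite zE; case: (t z).
  rewrite (_ : [forall z, _ ==> (support se w z == t z)] =
     [forall z, off z ==> (count (connect e z) w == t z)]); last first.
    apply: eq_forallb => z; rewrite /off ffunE has_count; congr implb.
    by case: (count _ _) (le1 z) (t z) => [|[|k]] // _ [].
  case: forallP => //= _; rewrite ffunE has_count /comul_coef.
  have := le1 p; rewrite np.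
  by move: (count _ _) (count _ _) (t p) (t q) => [|[|a]] [|[|b]] [] [].
have offn z : off z -> count (connect e' z) w = count (connect e z) w.
  move=> /andP[nz nz']; apply: eq_count => y; rewrite cE.
  by rewrite !(sy z) (negPf nz) (negPf nz') orbF.
have np : count (connect e' p) w = (count (connect e p) w + count (connect e p') w)%N.
  rewrite -count_predUI [X in (_ + X)%N](_ : _ = 0%N) ?addn0.
    by apply: eq_count => y /=; rewrite cE connect0 (negPf nepp) /= orbF.
  apply/eqP; rewrite -leqn0 leqNgt -has_count; apply/hasPn => y _ /=.
  by apply: contra nepp => /andP[py qy]; rewrite (same_connect se py) sy.
rewrite /mon (_ : [forall z, count (connect e' z) w == t z] =
      [forall z, off z ==> (count (connect e z) w == t z)] &&
          (count (connect e p) w + count (connect e p') w == t p)%N); last first.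
  apply/forallP/andP => [h|[/forallP h hp] z].
    split; last by rewrite -np.
    by apply/forallP => z; apply/implyP => /offn <-.
  have [oz|] := boolP (off z); first by rewrite offn // (implyP (h z)).
  rewrite /off negb_and !negbK => oz; have pz : connect e' p z.
    by rewrite cE connect0 (negPf nepp) /= orbF.
  by rewrite -(n'E _ _ pz) -(state_connect t pz) np.
have [/forallP le1|/forallPn[z]] := boolP [forall z, (count (connect e z) w <= 1)%N]; last first.
  rewrite -ltnNge => gt1; case: forallP => //= h.
  have [oz|] := boolP (off z).
    by have := implyP (h z) oz => /eqP zE; move: gt1; rewrite zE; case: (t z).
  rewrite /off negb_and !negbK => /orP[] pz; move: gt1; rewrite -(nE _ _ pz);
  by move: (count _ _) (count _ _) (t p) => [|[|a]] [|[|b]] [].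
rewrite (_ : [forall z, _ ==> (support se w z == t z)] =
   [forall z, off z ==> (count (connect e z) w == t z)]); last first.
  apply: eq_forallb => z; rewrite /off ffunE has_count; congr implb.
  by case: (count _ _) (le1 z) (t z) => [|[|k]] // _ [].
case: forallP => //= _; rewrite !ffunE !has_count /mul_coef.
have := le1 p; have := le1 p'.
by move: (count _ _) (count _ _) (t p) => [|[|a]] [|[|b]] [].
Qed.

Lemma saddleD e e' p q p' (v v' : tqft e) :
  saddle e' p q p' (v + v') = saddle e' p q p' v + saddle e' p q p' v'.
Proof.
apply/ffunP => t; rewrite !ffunE -big_split /=; apply: eq_bigr => s _.
by rewrite ffunE mulrDl.
Qed.

Lemma saddle_ev e e' p q p' L w : step e e' p q p' ->
  saddle e' p q p' [ffun s : state e => ev e L w s] =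
  [ffun t : state e' => ev e' (L ++ cut e p q p') w t].
Proof.
move=> st; elim: L w => [|pq L IH] w; first exact: saddle_mon.
rewrite (_ : [ffun s => _] = [ffun s : state e => ev e L (pq.1 :: w) s] +
   [ffun s : state e => ev e L (pq.2 :: w) s]); last by apply/ffunP => s; rewrite !ffunE.
by rewrite saddleD !IH; apply/ffunP => t; rewrite !ffunE.
Qed.

(** The saddle map carries the product over [L] to the product over [L] followed by the new factor,
    so it carries equalities along. *)
Lemma eqv_step e e' p q p' L L' : step e e' p q p' -> eqv e L L' ->
  eqv e' (L ++ cut e p q p') (L' ++ cut e p q p').
Proof.
move=> st LL w t; have [_ se' _ _ _] := st.
(* The saddle map has coefficients at states only; for any other [t] both sides are zero. *)
pose tf := [ffun z => t z].
have [tP|/forallPn[x /forallPn[y]]] := boolP [forall x, forall y, e' x y ==> (tf x == tf y)].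
  pose t' : state e' := State tP.
  have E K : ev e' K w t = ev e' K w t'.
    elim: K w => [|pq K IH] w /=; last by rewrite !IH.
    by rewrite /mon; congr (nat_of_bool _)%:Z; apply: eq_forallb => z; rewrite ffunE.
  have F K : ev e' (K ++ cut e p q p') w t' =
      saddle e' p q p' [ffun s : state e => ev e K w s] t'.
    by rewrite (saddle_ev _ _ st) ffunE.
  rewrite !E !F; congr (saddle _ _ _ _ _ t'); apply/ffunP => s; rewrite !ffunE; exact: LL.
rewrite negb_imply !ffunE => /andP[/connect1 xy nt].
have Z K : ev e' K w t = 0.
  by apply/eqP; apply: contraNT nt => /(ev_const se') /(_ xy) ->.
by rewrite !Z.
Qed.

End Monomials.

(** * Commutation of two saddles *)

Section Commutation.
Variable V : finType.
Implicit Types (e : rel V).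

Lemma step_n_comp e e' (p q p' : V) : step e e' p q p' ->
  (n_comp e' predT).+1 = (n_comp e predT + (connect e p p').*2)%N.
Proof.
case=> se se' _ _; case: ifP => _ J; last by rewrite (joins_n_comp se se' J) addn0.
by rewrite (joins_n_comp se' se J) addn2.
Qed.

Lemma mon_head e (x y : V) w t : connect_sym e -> connect e x y ->
  mon e (x :: w) t = mon e (y :: w) t.
Proof.
move=> se xy; congr (nat_of_bool _)%:Z; apply: eq_forallb => z.
by rewrite /= se (same_connect se xy) se.
Qed.

Lemma eqv_pair e (p q r s : V) : connect_sym e ->
  connect e p r && connect e q s || connect e p s && connect e q r ->
  eqv e [:: (p, q)] [:: (r, s)].
Proof.
move=> se /orP[] /andP[pr qs] w t /=; last rewrite [RHS]addrC;
by congr +%R; apply: mon_head.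
Qed.

Lemma eqv_swap e (pq rs : V * V) : eqv e [:: pq; rs] [:: rs; pq].
Proof.
move=> w t /=; rewrite addrACA; congr (_ + _ + (_ + _)); apply: mon_perm;
exact/seq.permP/(fun a => addnCA _ _ _).
Qed.

(* Counting circles, both orders have the same number of splittings. The saddle that
   splits can change with the order only if both saddles split (or merge) when
   performed first; then p, q, r, s lie on one circle of e12 (or {p, q} and {r, s}
   meet the same two circles). *)
Lemma step_comm e0 e1 e2 e12 (p q p' r s r' : V) :
    step e0 e1 p q p' -> step e1 e12 r s r' ->
    step e0 e2 r s r' -> step e2 e12 p q p' ->
  eqv e12 (cut e0 p q p' ++ cut e1 r s r') (cut e0 r s r' ++ cut e2 p q p').
Proof.
move=> s01 s112 s02 s212.
have cnt : (connect e0 p p' + connect e1 r r' = connect e0 r r' + connect e2 p p')%N.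
  move: (step_n_comp s01) (step_n_comp s112) (step_n_comp s02) (step_n_comp s212).
  move: (n_comp e0 _) (n_comp e1 _) (n_comp e2 _) (n_comp e12 _).
  move: (connect e0 p p') (connect e0 r r') (connect e1 r r') (connect e2 p p').
  clear; move=> a b c d; lia.
case: s01 => [se0 se1 pq0 pp1 J01]; case: s112 => [_ se12 rs1 rr12 J112].
case: s02 => [_ se2 rs0 rr2 J02]; case: s212 => [_ _ pq2 pp12 J212].
have sy12 a b : connect e12 a b = connect e12 b a by exact: se12.
have sy0 a b : connect e0 a b = connect e0 b a by exact: se0.
rewrite /cut; move: cnt; case: ifP J01 => i0; case: ifP J112 => j1;
  case: ifP J02 => j0; case: ifP J212 => i2 J212 J02 J112 J01 //= _;
  rewrite ?cats0; try by [exact: eqv_swap | move=> w t].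
(* Both saddles split when performed first. As [p] and [p'] share a circle of [e0] but not of [e2],
   that circle is the one split at [r]. *)
- have pr0 : connect e0 p r.
    apply: contraFT i2 => npr; have [_ cE] := J02; move: i0; rewrite cE.
    case/or3P=> // /andP[h _]; case/negP: npr; first exact: joins_sub J02 h.
    by apply: connect_trans (joins_sub J02 h) _; rewrite sy0.
  have pq12 := joins_sub J212 pq2; have rs12 := joins_sub J112 rs1.
  have pr12 : connect e12 p r.
    have [npq1 cE] := J01; move: pr0; rewrite cE connect0 (negPf npq1) orbF /=.
    case/orP=> /(joins_sub J112) // h; exact: connect_trans pq12 h.
  apply: eqv_pair => //; apply/orP; left; rewrite pr12 /=.
  by apply: connect_trans rs12; apply: connect_trans pr12; rewrite sy12.
(* Both saddles merge when performed first. In [e1] all of [p], [q], [r], [s] lie on one circle,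
   which [e12] splits in two; both pairs are separated by this split, so the two sums agree. *)
- have pq1 := joins_sub J01 pq0.
  have [npq12 _] := J212; have [nrs12 cE] := J112.
  have sy1 a b : connect e1 a b = connect e1 b a by exact: se1.
  have pr1 : connect e1 p r.
    move: pq1; rewrite cE (negPf npq12) /= => /orP[] /andP[h _].
      exact: joins_sub J112 h.
    by apply: connect_trans (joins_sub J112 h) _; rewrite sy1.
  have near x : connect e1 r x -> connect e12 r x || connect e12 s x.
    by rewrite cE connect0 (negPf nrs12) orbF.
  have := near p; rewrite sy1 => /(_ pr1).
  have := near q; rewrite -(same_connect se1 pr1) => /(_ pq1).
  have npq a : connect e12 a p -> connect e12 a q -> False.
    by move=> ap aq; case/negP: npq12; apply: connect_trans aq; rewrite sy12.
  move=> /orP[] rq /orP[] rp; try by [case: (npq _ rp rq)].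
    by apply: eqv_pair => //; rewrite rq rp orbT.
  by apply: eqv_pair => //; rewrite rq rp.
Qed.

End Commutation.

(** * Sequences of saddles, and the exchange of two families *)

Section Path.
Variables (V : finType) (St Mv : Type) (e : St -> rel V) (next : St -> Mv -> St).
Variables (p q p' : Mv -> V) (ok : St -> Mv -> bool).
Hypothesis okP : forall st m, ok st m -> step (e st) (e (next st m)) (p m) (q m) (p' m).

Fixpoint splits (l : seq Mv) (st : St) : seq (V * V) :=
  if l is m :: l' then cut (e st) (p m) (q m) (p' m) ++ splits l' (next st m)
  else [::].

Fixpoint oks (l : seq Mv) (st : St) : bool :=
  if l is m :: l' then ok st m && oks l' (next st m) else true.

Lemma splits_cat l1 l2 st :
  splits (l1 ++ l2) st = splits l1 st ++ splits l2 (foldl next st l1).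
Proof. by elim: l1 st => //= m l1 IH st; rewrite IH catA. Qed.

(** A saddle removes one circle when it merges and adds one when it splits. *)
Lemma splits_n_comp l st : oks l st ->
  (n_comp (e (foldl next st l)) predT + size l =
   n_comp (e st) predT + (size (splits l st)).*2)%N.
Proof.
elim: l st => [|m l IH] st //= /andP[/okP/step_n_comp st1 /IH IH'].
rewrite addnS -addSn size_cat /cut; move: st1 IH'; case: (connect _ _ _) => /=; lia.
Qed.

Lemma eqv_path l st L L' : oks l st -> eqv (e st) L L' ->
  eqv (e (foldl next st l)) (L ++ splits l st) (L' ++ splits l st).
Proof.
elim: l st L L' => [|m l IH] st L L' /=; first by rewrite !cats0.
move=> /andP[/okP st1 okl] LL; rewrite !catA; apply: IH => //.
exact: eqv_step.
Qed.

Section Exchange.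
Variables (A B : pred Mv).
Hypothesis nextC : forall st i j, A i -> B j -> next (next st i) j = next (next st j) i.
Hypothesis okC : forall st i j, A i -> B j -> ok st i -> ok st j ->
  ok (next st i) j && ok (next st j) i.

Lemma oks_insert i l st : A i -> all B l -> ok st i -> oks l st ->
  oks l (next st i) && ok (foldl next st l) i.
Proof.
move=> Ai; elim: l st => [|j l IH] st //= /andP[Bj Bl] oki /andP[okj okl].
by have /andP[-> oki'] := okC Ai Bj oki okj; rewrite (nextC _ Ai Bj) IH.
Qed.

Lemma foldl_insert i l st : A i -> all B l ->
  foldl next (next st i) l = next (foldl next st l) i.
Proof.
by move=> Ai; elim: l st => //= j l IH st /andP[Bj Bl]; rewrite nextC // IH.
Qed.

(** The saddle [i] moves past those of [l] one at a time. [step_comm] gives an equality at the stage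
    just after the swapped pair, and [eqv_path] carries it to the end of the sequence. *)
Lemma splits_insert i l st : A i -> all B l -> ok st i -> oks l st ->
  eqv (e (foldl next (next st i) l)) (splits (i :: l) st) (splits (l ++ [:: i]) st).
Proof.
move=> Ai; elim: l st => [|j l IH] st; first by move=> *.
move=> /= /andP[Bj Bl] oki /andP[okj okl].
have /andP[okij okji] := okC Ai Bj oki okj.
have /andP[okl' _] := oks_insert Ai Bl okji okl.
have E := step_comm (okP oki) (okP okij) (okP okj).
rewrite nextC // in E *; have {}E := eqv_path okl' (E (okP okji)).
move=> w t; rewrite catA E -catA; apply: eqv_catl; exact: IH.
Qed.

Lemma foldl_exchange l1 l2 st : all A l1 -> all B l2 ->
  foldl next (foldl next st l1) l2 = foldl next (foldl next st l2) l1.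
Proof.
move=> + Bl; elim: l1 st => //= i l1 IH st /andP[Ai Al].
by rewrite IH // foldl_insert.
Qed.

Lemma oks_exchange l1 l2 st : all A l1 -> all B l2 -> oks l1 st -> oks l2 st ->
  oks l2 (foldl next st l1) && oks l1 (foldl next st l2).
Proof.
move=> + Bl; elim: l1 st => [|i l1 IH] st /=; first by move=> _ _ ->.
move=> /andP[Ai Al] /andP[oki okl1] okl2.
have /andP[okl2' ->] := oks_insert Ai Bl oki okl2.
by have /andP[-> ] := IH _ Al okl1 okl2'; rewrite foldl_insert.
Qed.

Lemma splits_exchange l1 l2 st : all A l1 -> all B l2 -> oks l1 st -> oks l2 st ->
  eqv (e (foldl next st (l1 ++ l2))) (splits (l1 ++ l2) st) (splits (l2 ++ l1) st).
Proof.
move=> + Bl; elim: l1 st => [|i l1 IH] st /=; first by rewrite cats0.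
move=> /andP[Ai Al] /andP[oki okl1] okl2.
have /andP[okl2' oki'] := oks_insert Ai Bl oki okl2 => w t.
rewrite (eqv_catl _ (IH _ Al okl1 okl2')) -[in RHS]cat1s catA (splits_cat (l2 ++ _)).
rewrite foldl_cat /= [cut _ _ _ _ ++ _](_ : _ = splits ((i :: l2) ++ l1) st) //.
rewrite (splits_cat (i :: l2)) [in splits l1 (foldl _ _ (l2 ++ _))]foldl_cat /=.
rewrite -(foldl_insert _ Ai Bl).
have /andP[_ ok1] := oks_exchange Al Bl okl1 okl2'.
have := eqv_path ok1 (splits_insert Ai Bl oki okl2); rewrite -(foldl_exchange _ Al Bl).
exact.
Qed.

End Exchange.

End Path.

(** * The product and its associativity *)

Section Matching.
Variables (n : nat) (a : matching n).

Lemma arcK : involutive a.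
Proof. by move=> i; case: (a) => f /= /andP[/forallP/(_ i)/andP[_ /eqP]]. Qed.

Lemma arc_neq i : a i != i.
Proof. by case: (a) => f /= /andP[/forallP/(_ i)/andP[]]. Qed.

Lemma arc_nocross (i j : point n) : (i < j)%N -> (j < a i)%N -> (a i < a j)%N -> False.
Proof.
case: (a) => f /= /andP[_ /forallP/(_ i)/forallP/(_ j)/negP cr] h1 h2 h3.
by apply: cr; rewrite h1 h2 h3.
Qed.

Lemma card_arc (S : {set point n}) : (forall i, i \in S -> a i \in S) ->
  #|S| = (#|[set i in S | (i < a i)%N]|).*2.
Proof.
move=> Sa; set L := [set i in S | (i < a i)%N]; have -> : S = L :|: a @: L.
  apply/setP => i; rewrite !inE; apply/idP/orP => [iS|[/andP[]//|]]; last first.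
    by case/imsetP => j; rewrite inE => /andP[/Sa jS _] ->.
  have := arc_neq i; rewrite iS neq_ltn => /orP[ai|->]; last by left.
  by right; apply/imsetP; exists (a i); rewrite ?arcK // inE Sa //= arcK.
suff LI : L :&: a @: L = set0.
  by rewrite cardsU LI cards0 subn0 card_imset ?addnn //; exact: inv_inj arcK.
apply/setP => i; rewrite !inE; apply/negP => /andP[/andP[_ ia] /imsetP[j]].
by rewrite inE => /andP[_ ja] E; move: ia; rewrite E arcK ltnNge ltnW.
Qed.

(** The points strictly between the two ends of an arc are matched among themselves, as no arc
    crosses it; so their number is even. *)
Lemma arc_odd i : odd (a i) = ~~ odd i.
Proof.
have key (j : point n) : (j < a j)%N -> odd (a j) = ~~ odd j.
  move=> ja; pose S := [set k : point n | (j < k < a j)%N].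
  have Sa k : k \in S -> a k \in S.
    rewrite !inE => /andP[jk ka].
    have nj : a k != j by apply: contraTneq ka => <-; rewrite arcK ltnn.
    have nk : a k != a j by rewrite (inv_eq arcK) arcK; apply: contraTneq jk => ->; rewrite ltnn.
    have [jk'|kj|/val_inj E] := ltngtP j (a k); last by rewrite -E eqxx in nj.
      have [//|kj'|/val_inj E] := ltngtP (a k) (a j); last by rewrite E eqxx in nk.
      by case: (arc_nocross jk ka).
    by case: (@arc_nocross (a k) j); rewrite ?arcK.
  have := card_arc Sa; rewrite cardE -(size_map val).
  have /perm_size -> : perm_eq (map val (enum S)) (iota j.+1 (a j - j.+1)).
    apply: uniq_perm; rewrite ?iota_uniq //.
      by rewrite map_inj_uniq ?enum_uniq //; exact: val_inj.
    move=> k; rewrite mem_iota subnKC //; apply/mapP/idP => [[l + ->]|].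
      by rewrite mem_enum inE.
    move=> /andP[jk ka]; exists (Ordinal (ltn_trans ka (ltn_ord (a j)))) => //.
    by rewrite mem_enum inE jk.
  rewrite size_iota => E; have -> : (a j : nat) = (j.+1 + (a j - j.+1))%N by rewrite subnKC.
  by rewrite oddD E odd_double addbF.
have := arc_neq i; rewrite neq_ltn => /orP[ai|/key //].
by have := key (a i); rewrite arcK => ->; rewrite ?negbK.
Qed.

Lemma size_left_endpoints : size (left_endpoints a) = n.
Proof.
have -> : size (left_endpoints a) = #|[set i : point n in setT | (i < a i)%N]|.
  rewrite cardE; apply/perm_size/uniq_perm.
  - exact/filter_uniq/enum_uniq.
  - exact: enum_uniq.
  by move=> i; rewrite mem_filter !mem_enum !inE andbT.
have := @card_arc setT; rewrite cardsT card_ord => /(_ (fun _ _ => in_setT _)).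
by move: #|_| => k; lia.
Qed.

Lemma W_sym (b : matching n) : connect_sym (W b a).
Proof. apply: glue_sym arcK; by move=> i; case: (b) => f /= /andP[/forallP/(_ i)/andP[_ /eqP]]. Qed.

End Matching.

Lemma connect_map (V V' : finType) (e : rel V) (e' : rel V') (h : V -> V') x y :
    (forall u v, e u v -> connect e' (h u) (h v)) ->
  connect e x y -> connect e' (h x) (h y).
Proof.
move=> he /connectP[s + ->]; elim: s x => [|z s IH] x /=; first by rewrite connect0.
by case/andP=> /he xz /IH; exact: connect_trans.
Qed.

Section EvMap.
Variables (V V' : finType) (e : rel V) (e' : rel V') (h : V -> V').
Hypothesis he : forall x y, connect e x y = connect e' (h x) (h y).
Variable k : V' -> V.
Hypothesis kK : cancel k h.

Definition hpair (pq : V * V) := (h pq.1, h pq.2).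

(** Coefficients depend on circles alone, so a surjection that respects circles transports them. It
    serves to forget the rows once vertical segments join them. *)
Lemma ev_map L w t : ev e L w (t \o h) = ev e' (map hpair L) (map h w) t.
Proof.
elim: L w => [|pq L IH] w /=; last by rewrite !IH.
congr (nat_of_bool _)%:Z; apply/forallP/forallP => [ht z|ht z].
  rewrite count_map -{2}(kK z) -(eqP (ht (k z))); apply/eqP/eq_count => y /=.
  by rewrite he kK.
rewrite /= -(eqP (ht (h z))) count_map; apply/eqP/eq_count => y /=; exact: he.
Qed.

Lemma n_comp_map : connect_sym e -> connect_sym e' -> n_comp e predT = n_comp e' predT.
Proof.
move=> se se'; apply/esym; rewrite (adjunction_n_comp h se' se) //.
split=> [x _|x y _]; last exact: he.
by exists (k x); rewrite kK.
Qed.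

End EvMap.

(** * The product of two blocks as a sequence of saddles *)

Section TwoRows.
Variables (n : nat) (c b a : matching n).
Implicit Types (S : {set point n}) (l : seq (point n)).

(** The orientation of the two-row diagram: an arc changes the parity of the point and keeps the
    row, a vertical segment does the opposite. *)
Definition sign2 (z : point n * bool) := odd z.1 (+) z.2.

Lemma outerK : involutive (outer c a).
Proof. by move=> [i []]; rewrite /outer /= arcK. Qed.

Definition stable S := [forall i, (b i \in S) == (i \in S)].

Lemma innerK S : stable S -> involutive (inner b S).
Proof.
move=> /forallP Sb [i r]; rewrite /inner /=; case iS: (i \in S); rewrite /= ?iS ?negbK //.
by rewrite (eqP (Sb i)) iS arcK.
Qed.

Lemma surger_stable S i : stable S -> stable (surger b S i).
Proof.
move=> /forallP Sb; apply/forallP => j; rewrite !inE (eqP (Sb j)) (inv_eq (arcK b)).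
by rewrite (inv_eq (arcK b)) arcK orbCA.
Qed.

Lemma stage_step S i : stable S && (i \notin S) ->
  step (stage c b a S) (stage c b a (surger b S i)) (i, true) (b i, true) (i, false).
Proof.
move=> /andP[Sb iS]; have Sb' := surger_stable i Sb.
have gE r : inner b S (i, r) = (b i, r) by rewrite /inner /= (negPf iS).
have := @surgery_step _ (outer c a) (inner b S) (inner b (surger b S i)) sign2 (i, true) (i, false).
rewrite gE; apply; rewrite ?gE //.
- exact: outerK.
- exact: innerK.
- exact: innerK.
- by move=> [j []]; rewrite /sign2 /= arc_odd; case: (odd j).
- move=> [j r]; rewrite /sign2 /inner; case: ifP => _ /=; last by rewrite arc_odd addNb.
  by rewrite addbN.
- by rewrite /sign2 /= addbT addbF negbK.
- by rewrite xpair_eqE andbF.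
move=> [j r]; rewrite /inner /= !xpair_eqE !inE /=.
have [->|ji] := eqVneq j i; first by case: r.
have [->|jbi] /= := eqVneq j (b i); first by case: r.
by [].
Qed.

Definition splits2 l S : seq (point n * point n) :=
  map (hpair fst) (splits (stage c b a) (surger b) (fun i => (i, true))
    (fun i => (b i, true)) (fun i => (i, false)) l S).

Notation oks2 := (oks (surger b) (fun S i => stable S && (i \notin S))).

(** Each arc is listed once, by its left end, so a saddle never meets an arc already replaced. *)
Lemma oks_left : oks2 (left_endpoints b) set0.
Proof.
have : uniq (left_endpoints b) by exact/filter_uniq/enum_uniq.
have : all (fun i : point n => i < b i)%N (left_endpoints b) by exact: filter_all.
have : stable set0 by apply/forallP => i; rewrite !inE.
have : all (fun i => i \notin (set0 : {set point n})) (left_endpoints b).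
  by apply/allP => i; rewrite inE.
elim: (left_endpoints b) set0 => //= i l IH S /andP[iS lS] Sb /andP[ib lb] /andP[il ul].
rewrite Sb iS /=; apply: IH => //; last exact: surger_stable.
apply/allP => j jl; rewrite !inE (negPf (allP lS j jl)) orbF negb_or.
apply/andP; split; first by apply: contraNneq il => <-.
apply: contraTneq ib => E; have := allP lb j jl; rewrite E arcK.
by rewrite -leqNgt; exact: ltnW.
Qed.

Lemma saddles_ev L w l S : oks2 l S ->
  saddles l [ffun s : state (stage c b a S) => ev (stage c b a S) L w s] =
  [ffun t : state (stage c b a (foldl (surger b) S l)) =>
     ev (stage c b a (foldl (surger b) S l))
       (L ++ splits (stage c b a) (surger b) (fun i => (i, true))
        (fun i => (b i, true)) (fun i => (i, false)) l S) w t].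
Proof.
elim: l S L => [|i l IH] S L /=; first by rewrite cats0.
move=> /andP[iS okl]; rewrite (saddle_ev _ _ (stage_step iS)) IH //.
by rewrite catA.
Qed.

Lemma connect_stage0 i r j r' : connect (stage c b a set0) (i, r) (j, r') =
  (r == r') && connect (if r then W c b else W b a) i j.
Proof.
apply/idP/idP => [ij|/andP[/eqP <- ij]].
  have rr : r = r'.
    have cl : closed (stage c b a set0) [pred z | z.2 == r].
      move=> [u x] [v y]; rewrite /stage /glue /outer /inner inE !xpair_eqE /=.
      by case/orP => /andP[_ /eqP ->].
    by have := closed_connect cl ij; rewrite !inE eqxx => /esym/eqP.
  rewrite -rr eqxx /=.
  (* The other row goes to the dummy point [i]; no edge joins the rows, so its edges become
     trivial. *)
  pose h (z : point n * bool) := if z.2 == r then z.1 else i.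
  have := @connect_map _ _ (stage c b a set0) (if r then W c b else W b a) h (i, r) (j, r').
  rewrite /h /= -rr eqxx; apply; last by rewrite {2}rr.
  move=> [u x] [v y]; rewrite /stage /glue /outer /inner inE !xpair_eqE /=.
  case/orP => /andP[/eqP <- /eqP <-]; case: eqP => [xr|_]; rewrite ?xr ?connect0 //;
  by case: (r); rewrite /W ?connect_gluel ?connect_gluer.
apply: (@connect_map _ _ (if r then W c b else W b a) _ (fun z => (z, r))) ij => u v.
rewrite /stage; case: r => /orP[] /eqP <-.
- exact: (connect_gluel (outer c a) (inner b set0) (u, true)).
- by have := connect_gluer (outer c a) (inner b set0) (u, true); rewrite /inner inE.
- by have := connect_gluer (outer c a) (inner b set0) (u, false); rewrite /inner inE.
- exact: (connect_gluel (outer c a) (inner b set0) (u, false)).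
Qed.

Lemma connect_stageT S x y : (forall i, i \in S) ->
  connect (stage c b a S) x y = connect (W c a) x.1 y.1.
Proof.
move=> ST; apply/idP/idP.
  apply: connect_map => -[u r] [v r']; rewrite /stage /glue /inner /outer ST !xpair_eqE /=.
  case/orP => /andP[/eqP <- _]; rewrite ?connect0 //.
  by case: r; rewrite /W ?connect_gluel ?connect_gluer.
have flip i r : connect (stage c b a S) (i, r) (i, ~~ r).
  by have := connect_gluer (outer c a) (inner b S) (i, r); rewrite /inner ST.
have any i r r' : connect (stage c b a S) (i, r) (i, r').
  by case: r r' => [] []; rewrite ?connect0 ?(flip i true) ?(flip i false).
case: x y => [i r] [j r'] /= ij; apply: connect_trans (any i r true) _.
apply: connect_trans (any j true r').
apply: (@connect_map _ _ (W c a) _ (fun z => (z, true))) ij => u v.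
case/orP => /eqP <-; first exact: (connect_gluel (outer c a) (inner b S) (u, true)).
apply: connect_trans (any u true false) _; apply: connect_trans (any _ false true).
exact: (connect_gluel (outer c a) (inner b S) (u, false)).
Qed.

Definition row r (w : seq (point n)) : seq (point n * bool) := [seq (i, r) | i <- w].

Lemma juxtapose_mon w1 w2 :
  juxtapose [ffun s : state (W c b) => mon (W c b) w1 s]
            [ffun s : state (W b a) => mon (W b a) w2 s] =
  [ffun s : state (stage c b a set0) => mon (stage c b a set0) (row true w1 ++ row false w2) s].
Proof.
apply/ffunP => s; rewrite !ffunE /mon -PoszM mulnb; congr (nat_of_bool _)%:Z.
have E i r : count (connect (stage c b a set0) (i, r)) (row true w1 ++ row false w2) =
    count (connect (if r then W c b else W b a) i) (if r then w1 else w2).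
  rewrite count_cat !count_map; set e := stage _ _ _ _.
  have C r' w : count (preim (fun j => (j, r')) (connect e (i, r))) w =
      if r == r' then count (connect (if r then W c b else W b a) i) w else 0%N.
    transitivity (count (fun j => (r == r') && connect (if r then W c b else W b a) i j) w).
      by apply: eq_count => j; exact: connect_stage0.
    by case: eqP => // _; rewrite count_pred0.
  by rewrite !C; case: r {C}; rewrite ?addn0.
apply/andP/forallP => [[/forallP h1 /forallP h2] [i r]|h].
  by rewrite E; case: r; [have := h1 i|have := h2 i]; rewrite /= ffunE.
by split; apply/forallP => i; [have := h (i, true)|have := h (i, false)]; rewrite E /= ffunE.
Qed.

(** The product of the units of F(W(c)b) and F(W(b)a), written as a product of sums X_p + X_q. *)
Definition split_factor := splits2 (left_endpoints b) set0.

Lemma mult_mon w1 w2 :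
  mult [ffun s : state (W c b) => mon (W c b) w1 s]
       [ffun s : state (W b a) => mon (W b a) w2 s] =
  [ffun t : state (W c a) => ev (W c a) split_factor (w1 ++ w2) t].
Proof.
apply/ffunP => t; rewrite !ffunE juxtapose_mon (saddles_ev [::] _ oks_left) ffunE /=.
set e := stage _ _ _ _; set L := splits _ _ _ _ _ _ _.
have he x y : connect e x y = connect (W c a) x.1 y.1.
  by apply: connect_stageT; exact: all_surgered.
have -> K w : ev e K w (label (vertical b t)) = ev e K w (t \o fst).
  elim: K w => [|pq K IH] w /=; last by rewrite !IH.
  by congr (nat_of_bool _)%:Z; apply: eq_forallb => z; rewrite ffunE.
rewrite (ev_map he (k := fun i => (i, true))) //.
by rewrite map_cat -!map_comp !map_id.
Qed.

(** The circle count over all n saddles. Both the grading of the product and the absence of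
    splittings next to a diagonal block follow from it. *)
Lemma split_factor_n_comp :
  (n_comp (W c a) predT + n =
   n_comp (W c b) predT + n_comp (W b a) predT + (size split_factor).*2)%N.
Proof.
have := splits_n_comp stage_step oks_left; rewrite size_left_endpoints.
rewrite (@n_comp_map _ _ _ (W c a) fst _ (fun i => (i, true))) //; last 3 first.
- by move=> x y; apply: connect_stageT; exact: all_surgered.
- apply: glue_sym outerK _; apply: innerK.
  by apply/forallP => i; rewrite !all_surgered.
- exact: W_sym.
rewrite /split_factor /splits2 size_map => ->; congr (_ + _)%N.
have s0 : connect_sym (stage c b a set0).
  by apply: glue_sym outerK (innerK _); apply/forallP => i; rewrite !inE.
have cl r : closed (stage c b a set0) [pred z | z.2 == r].
  move=> [u x] [v y]; rewrite /stage /glue /outer /inner inE !xpair_eqE /=.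
  by case/orP => /andP[_ /eqP ->].
rewrite (n_compC [pred z | z.2 == true]); congr (_ + _)%N.
  rewrite (adjunction_n_comp (fun i => (i, true)) s0 (@W_sym n b c) (cl true)) //.
  split=> [[i r] /eqP /= ->|i j _]; first by exists i.
  by rewrite connect_stage0.
rewrite -(eq_n_comp_r (a := [pred z | z.2 == false])); last by move=> [i []].
rewrite (adjunction_n_comp (fun i => (i, false)) s0 (@W_sym n a b) (cl false)) //.
split=> [[i r] /eqP /= ->|i j _]; first by exists i.
by rewrite connect_stage0.
Qed.

End TwoRows.

Lemma glueC (V : finType) (f g : V -> V) : connect (glue f g) =2 connect (glue g f).
Proof. by apply: eq_connect => x y; rewrite /glue orbC. Qed.

Lemma eq_step (V : finType) (e0 e1 e0' e1' : rel V) (p q p' : V) :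
    connect e0 =2 connect e0' -> connect e1 =2 connect e1' ->
  step e0 e1 p q p' -> step e0' e1' p q p'.
Proof.
move=> E0 E1 [s0 s1 pq pp J]; split; rewrite -?E0 -?E1 //.
- by move=> x y; rewrite -!E0 s0.
- by move=> x y; rewrite -!E1 s1.
by case: ifP J => _ [nJ J]; split=> [|x y]; rewrite -?E0 -?E1 // J !(E0, E1).
Qed.

(** * The three-row diagram behind associativity *)

Section ThreeRows.
Variables (n : nat) (d c b a : matching n).
Implicit Types (S T : {set point n}) (i j : point n).

(* W(d) c W(c) b W(b) a is cut along the rows [Some true] (between W(d) and c),
   [None] (between W(c) and b) and [Some false] (between W(b) and a). In
   [slide r u m S] the row [Some r] carries the arcs of u, and the arcs of m on the
   other two rows are replaced by vertical segments at the points of S. *)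
Definition slide (r : bool) (u m : matching n) S (z : point n * option bool) :=
  if z.2 == Some r then (u z.1, z.2)
  else if z.1 \in S then (z.1, if z.2 is None then Some (~~ r) else None)
  else (m z.1, z.2).

(** Every vertical segment has exactly one end on the middle row, so flipping that row orients the
    diagram. *)
Definition sign3 (z : point n * option bool) := odd z.1 (+) (z.2 == None).

Lemma slideK r u m S : stable m S -> involutive (slide r u m S).
Proof.
move=> /forallP Sm [i s]; rewrite /slide /=.
case: (eqVneq s (Some r)) => [->|sr] /=; first by rewrite eqxx arcK.
case iS: (i \in S) => /=; last by rewrite (negPf sr) (eqP (Sm i)) iS arcK.
by case: s sr => [[]|]; case: r => //= _; rewrite iS.
Qed.

Lemma slide_sign r u m S z : sign3 (slide r u m S z) = ~~ sign3 z.
Proof.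
case: z => i s; rewrite /slide /sign3 /=.
case: ifP => _ /=; first by rewrite arc_odd addNb.
by case: ifP => _ /=; [case: s => [[]|]; case: (odd i)|rewrite arc_odd addNb].
Qed.

Definition stage3 (st : {set point n} * {set point n}) :=
  glue (slide true d b st.2) (slide false a c st.1).

Definition upper_row (m : bool * point n) := if m.1 then Some true else None.
Definition lower_row (m : bool * point n) := if m.1 then None else Some false.
Definition next3 (st : {set point n} * {set point n}) (m : bool * point n) :=
  if m.1 then (surger c st.1 m.2, st.2) else (st.1, surger b st.2 m.2).
Definition p3 (m : bool * point n) := (m.2, upper_row m).
Definition q3 (m : bool * point n) := ((if m.1 then c m.2 else b m.2), upper_row m).
Definition p3' (m : bool * point n) := (m.2, lower_row m).
Definition ok3 (st : {set point n} * {set point n}) (m : bool * point n) :=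
  [&& stable c st.1, stable b st.2 & m.2 \notin (if m.1 then st.1 else st.2)].

(** One statement for the saddles of both inner matchings: [x] and [y] are the rows other than
    [Some r], in either order. *)
Lemma slide_step r u m S f i x y :
    (x == Some r) || (y == Some r) = false -> x != y -> (x == None) || (y == None) ->
    involutive f -> (forall z, sign3 (f z) = ~~ sign3 z) ->
    stable m S -> i \notin S ->
  step (glue f (slide r u m S)) (glue f (slide r u m (surger m S i)))
    (i, x) (m i, x) (i, y).
Proof.
move=> /norP[xr yr] xy xyN fK fS Sm iS; have Sm' := surger_stable i Sm.
have gE s : s != Some r -> slide r u m S (i, s) = (m i, s).
  by move=> sr; rewrite /slide /= (negPf iS) (negPf sr).
have := @surgery_step _ f (slide r u m S) (slide r u m (surger m S i)) sign3 (i, x) (i, y).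
rewrite !gE //; apply=> //; try exact: slideK; try exact: slide_sign.
- by rewrite /sign3 /=; case: (x) (y) xy xyN => [[]|] [[]|] //; case: (odd i).
- by rewrite xpair_eqE negb_and (eq_sym y) xy orbT.
move=> [j s]; rewrite /slide /= !xpair_eqE !inE /=.
have [sr|sr] := eqVneq s (Some r).
  by rewrite sr !(eq_sym (Some r)) (negPf xr) (negPf yr) !andbF.
have [sx sy] : (s == x = ~~ (s == y)) /\
   (if s is None then Some (~~ r) else None) = if s == x then y else x.
  by case: s x y sr xr yr xy xyN => [[]|] [[]|] [[]|]; case: (r).
rewrite sy sx; have [->|ji] := eqVneq j i; first by case: (s == y).
have [->|jbi] /= := eqVneq j (m i); first by case: (s == y).
by [].
Qed.

Lemma stage3_step st m : ok3 st m ->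
  step (stage3 st) (stage3 (next3 st m)) (p3 m) (q3 m) (p3' m).
Proof.
case: st m => S T [[] i] /and3P[/= Sc Tb iS]; rewrite /next3 /p3 /q3 /p3' /stage3 /=.
  by apply: slide_step => //; [exact: slideK|exact: slide_sign].
(* The saddles of [b] change the first of the two glued involutions, while [slide_step] changes the
   second. *)
apply: (eq_step (glueC _ _) (glueC _ _)).
by apply: slide_step => //; [exact: slideK|exact: slide_sign].
Qed.

Lemma next3C st (i j : bool * point n) : i.1 -> ~~ j.1 ->
  next3 (next3 st i) j = next3 (next3 st j) i.
Proof. by case: i j => [[] i] [[] j]. Qed.

Lemma ok3C st (i j : bool * point n) : i.1 -> ~~ j.1 -> ok3 st i -> ok3 st j ->
  ok3 (next3 st i) j && ok3 (next3 st j) i.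
Proof.
case: i j => [[] i] [[] j] //= _ _ /and3P[/= Sc Tb iS] /and3P[/= _ _ jT].
by rewrite /ok3 /= Sc Tb iS jT !surger_stable.
Qed.

Definition splits3 := splits stage3 next3 p3 q3 p3'.

Lemma connect_slidel st x : connect (stage3 st) x (slide true d b st.2 x).
Proof. exact: connect_gluel. Qed.

Lemma connect_slider st x : connect (stage3 st) x (slide false a c st.1 x).
Proof. exact: connect_gluer. Qed.

Lemma connect_outer (u m l : matching n) S x : connect (stage u m l S) x (outer u l x).
Proof. exact: connect_gluel. Qed.

Lemma connect_inner (u m l : matching n) S x : connect (stage u m l S) x (inner m S x).
Proof. exact: connect_gluer. Qed.

Lemma connect_iso (V V' : finType) (e : rel V) (e' : rel V') (h : V -> V') (k : V' -> V) x y :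
    connect_sym e ->
    (forall u v, e u v -> connect e' (h u) (h v)) ->
    (forall u v, e' u v -> connect e (k u) (k v)) ->
    (forall u, connect e u (k (h u))) ->
  connect e x y = connect e' (h x) (h y).
Proof.
move=> se he ke kh; apply/idP/idP; first exact: connect_map.
move=> /(connect_map ke) h'; apply: connect_trans (kh x) _.
by apply: connect_trans h' _; rewrite se.
Qed.

Lemma stage3_sym S T : stable c S -> stable b T -> connect_sym (stage3 (S, T)).
Proof. by move=> Sc Tb; apply: glue_sym; apply: slideK. Qed.

Definition top2 (z : point n * bool) := (z.1, if z.2 then Some true else None).
Definition bot2 (z : point n * bool) := (z.1, if z.2 then None else Some false).
Definition squash_top (z : point n * option bool) := (z.1, z.2 != Some false).
Definition squash_bot (z : point n * option bool) := (z.1, z.2 == Some true).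

Lemma connect_top S x y :
  connect (stage d c b S) x y = connect (stage3 (S, set0)) (top2 x) (top2 y).
Proof.
apply/idP/idP.
  apply: connect_map => -[i r] _ /orP[] /eqP <-.
    have := connect_slidel (S, set0) (top2 (i, r)).
    by rewrite /slide /top2 /outer /= inE; case: r.
  have := connect_slider (S, set0) (top2 (i, r)).
  by rewrite /slide /top2 /inner /=; case: r; case: ifP.
(* As long as no saddle of [b] is performed, the bottom row is not attached to the others, so [h]
   may send it to [x]. *)
pose h (z : point n * option bool) :=
  match z.2 with Some true => (z.1, true) | None => (z.1, false) | _ => x end.
have hK z : h (top2 z) = z by case: z => i [].
rewrite -{2}[x]hK -{2}[y]hK; apply: connect_map => -[i r] _ /orP[] /eqP <-.
  have := connect_outer d c b S; rewrite /slide /outer /h /= inE.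
  by case: r => [[]|] E; [exact: (E (i, true))|exact: connect0|exact: (E (i, false))].
have := connect_inner d c b S; rewrite /slide /inner /h /=.
by case: r => [[]|] E;
  [have := E (i, true)|exact: connect0|have := E (i, false)]; rewrite /=; case: ifP.
Qed.

Lemma connect_bot T x y :
  connect (stage c b a T) x y = connect (stage3 (set0, T)) (bot2 x) (bot2 y).
Proof.
apply/idP/idP.
  apply: connect_map => -[i r] _ /orP[] /eqP <-.
    have := connect_slider (set0, T) (bot2 (i, r)).
    by rewrite /slide /bot2 /outer /= inE; case: r.
  have := connect_slidel (set0, T) (bot2 (i, r)).
  by rewrite /slide /bot2 /inner /=; case: r; case: ifP.
pose h (z : point n * option bool) :=
  match z.2 with None => (z.1, true) | Some false => (z.1, false) | _ => x end.
have hK z : h (bot2 z) = z by case: z => i [].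
rewrite -{2}[x]hK -{2}[y]hK; apply: connect_map => -[i r] _ /orP[] /eqP <-; last first.
  have := connect_outer c b a T; rewrite /slide /outer /h /= inE.
  by case: r => [[]|] E; [exact: connect0|exact: (E (i, false))|exact: (E (i, true))].
have := connect_inner c b a T; rewrite /slide /inner /h /=.
by case: r => [[]|] E;
  [exact: connect0|have := E (i, false)|have := E (i, true)]; rewrite /=; case: ifP.
Qed.

(** Once all arcs of [c] are vertical segments, the top and middle rows act as one row, and the
    two-row diagram of the product through [b] is left. *)
Lemma connect_squash_top S T x y : stable b T -> (forall i, i \in S) ->
  connect (stage3 (S, T)) x y = connect (stage d b a T) (squash_top x) (squash_top y).
Proof.
move=> Tb ST; have Sc : stable c S by apply/forallP => i; rewrite !ST.
have flip i : connect (stage3 (S, T)) (i, Some true) (i, None).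
  by have := connect_slider (S, T) (i, Some true); rewrite /slide /= ST.
have se := stage3_sym Sc Tb; have flip' i : connect (stage3 (S, T)) (i, None) (i, Some true).
  by rewrite se.
pose k (z : point n * bool) := (z.1, if z.2 then Some true else Some false).
apply: (@connect_iso _ _ _ _ squash_top k) => //.
- move=> [i r] _ /orP[] /eqP <-; rewrite /slide /squash_top /= ?ST.
    have O := connect_outer d b a T; have I := connect_inner d b a T.
    case: r => [[]|] /=; first exact: (O (i, true)).
      by have := I (i, false); rewrite /inner /=; case: ifP.
    by have := I (i, true); rewrite /inner /=; case: ifP.
  case: r => [[]|] /=; rewrite ?connect0 //.
  exact: (connect_outer d b a T (i, false)).
- move=> [i r] _ /orP[] /eqP <-; rewrite /inner /outer /k /=.
    case: r; first exact: (connect_slidel (S, T) (i, Some true)).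
    exact: (connect_slider (S, T) (i, Some false)).
  have := connect_slidel (S, T) (i, if r then None else Some false).
  rewrite /slide /=; case: r => /=; case: ifP => //= _ E.
  - by apply: connect_trans (flip i) E.
  - by apply: connect_trans (flip i) _; apply: connect_trans E (flip' _).
  by apply: connect_trans E (flip' _).
by move=> [i [[]|]]; rewrite /k /squash_top /= ?connect0.
Qed.

Lemma connect_squash_bot S T x y : stable c S -> (forall i, i \in T) ->
  connect (stage3 (S, T)) x y = connect (stage d c a S) (squash_bot x) (squash_bot y).
Proof.
move=> Sc TT; have Tb : stable b T by apply/forallP => i; rewrite !TT.
have flip i : connect (stage3 (S, T)) (i, Some false) (i, None).
  by have := connect_slidel (S, T) (i, Some false); rewrite /slide /= TT.
have se := stage3_sym Sc Tb; have flip' i : connect (stage3 (S, T)) (i, None) (i, Some false).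
  by rewrite se.
pose k (z : point n * bool) := (z.1, if z.2 then Some true else Some false).
apply: (@connect_iso _ _ _ _ squash_bot k) => //.
- move=> [i r] _ /orP[] /eqP <-; rewrite /slide /squash_bot /= ?TT.
    case: r => [[]|] /=; rewrite ?connect0 //.
    exact: (connect_outer d c a S (i, true)).
  have O := connect_outer d c a S; have I := connect_inner d c a S.
  case: r => [[]|] /=; last by have := I (i, false); rewrite /inner /=; case: ifP.
    by have := I (i, true); rewrite /inner /=; case: ifP.
  exact: (O (i, false)).
- move=> [i r] _ /orP[] /eqP <-; rewrite /inner /outer /k /=.
    case: r; first exact: (connect_slidel (S, T) (i, Some true)).
    exact: (connect_slider (S, T) (i, Some false)).
  have := connect_slider (S, T) (i, if r then Some true else None).
  rewrite /slide /=; case: r => /=; case: ifP => //= _ E.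
  - by apply: connect_trans E (flip' _).
  - by apply: connect_trans (flip i) E.
  by apply: connect_trans (flip i) _; apply: connect_trans E (flip' _).
by move=> [i [[]|]]; rewrite /k /squash_bot /= ?connect0.
Qed.

Lemma splits3_top l S :
  map (hpair fst) (splits3 (map (pair true) l) (S, set0)) = splits2 d c b l S.
Proof.
rewrite /splits2 /splits3; elim: l S => //= i l IH S; rewrite !map_cat IH.
by congr cat; rewrite /cut (connect_top S (i, true) (i, false)); case: ifP.
Qed.

Lemma splits3_bot l T :
  map (hpair fst) (splits3 (map (pair false) l) (set0, T)) = splits2 c b a l T.
Proof.
rewrite /splits2 /splits3; elim: l T => //= i l IH T; rewrite !map_cat IH.
by congr cat; rewrite /cut (connect_bot T (i, true) (i, false)); case: ifP.
Qed.

Lemma splits3_squash_top l S T : stable b T -> (forall i, i \in S) ->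
  map (hpair fst) (splits3 (map (pair false) l) (S, T)) = splits2 d b a l T.
Proof.
rewrite /splits2 /splits3 => + ST; elim: l T => //= i l IH T Tb.
rewrite !map_cat IH; last exact: surger_stable.
congr cat; rewrite /cut (connect_squash_top _ _ Tb ST).
by rewrite /squash_top /=; case: ifP.
Qed.

Lemma splits3_squash_bot l S T : stable c S -> (forall i, i \in T) ->
  map (hpair fst) (splits3 (map (pair true) l) (S, T)) = splits2 d c a l S.
Proof.
rewrite /splits2 /splits3 => + TT; elim: l S => //= i l IH S Sc.
rewrite !map_cat IH; last exact: surger_stable.
congr cat; rewrite /cut (connect_squash_bot _ _ Sc TT).
by rewrite /squash_bot /=; case: ifP.
Qed.

Lemma foldl_top l st : foldl next3 st (map (pair true) l) = (foldl (surger c) st.1 l, st.2).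
Proof. by elim: l st => [|i l IH] [S T] //=; rewrite IH. Qed.

Lemma foldl_bot l st : foldl next3 st (map (pair false) l) = (st.1, foldl (surger b) st.2 l).
Proof. by elim: l st => [|i l IH] [S T] //=; rewrite IH. Qed.

Lemma oks_top l S :
  oks (surger c) (fun S i => stable c S && (i \notin S)) l S ->
  oks next3 ok3 (map (pair true) l) (S, set0).
Proof.
have s0 : stable b set0 by apply/forallP => i; rewrite !inE.
elim: l S => //= i l IH S /andP[/andP[Sc iS] /IH].
by rewrite /ok3 /= Sc iS s0.
Qed.

Lemma oks_bot l T :
  oks (surger b) (fun S i => stable b S && (i \notin S)) l T ->
  oks next3 ok3 (map (pair false) l) (set0, T).
Proof.
have s0 : stable c set0 by apply/forallP => i; rewrite !inE.
elim: l T => //= i l IH T /andP[/andP[Tb iT] /IH].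
by rewrite /ok3 /= Tb iT s0.
Qed.

(** Performing all saddles of [c] before those of [b] computes (xy)z, the other order x(yz). The two
    families are disjoint, so [splits_exchange] compares the orders. *)
Lemma split_factorA :
  eqv (W d a) (split_factor d c b ++ split_factor d b a)
              (split_factor c b a ++ split_factor d c a).
Proof.
pose lc := map (pair true) (left_endpoints c); pose lb := map (pair false) (left_endpoints b).
pose full m := foldl (surger m) set0 (left_endpoints m) : {set point n}.
have fullP m i : i \in full m by exact: all_surgered.
have s0 m : stable m set0 by apply/forallP => i; rewrite !inE.
have Al : all (fun m : bool * point n => m.1) lc by apply/allP => _ /mapP[i _ ->].
have Bl : all (fun m : bool * point n => ~~ m.1) lb by apply/allP => _ /mapP[i _ ->].
have := splits_exchange stage3_step next3C ok3C Al Bl (oks_top (oks_left c))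
  (oks_bot (oks_left b)).
rewrite !splits_cat foldl_cat /lc /lb !foldl_top !foldl_bot /= -/(full c) -/(full b).
rewrite -/splits3 => E w t.
have he x y : connect (stage3 (full c, full b)) x y = connect (W d a) x.1 y.1.
  rewrite connect_squash_top ?connect_stageT //.
  by apply/forallP => i; rewrite !fullP.
have := E (map (fun i => (i, None)) w) (t \o fst).
rewrite !(ev_map he (k := fun i => (i, None))) //.
rewrite !map_cat -!map_comp !map_id splits3_top splits3_bot.
by rewrite splits3_squash_top // splits3_squash_bot.
Qed.

End ThreeRows.

(** Makes the [raddf] lemmas available for a map that is only proved additive locally. *)
Definition pack_additive (U U' : zmodType) (F : U -> U')
    (FB : GRing.zmod_morphism F) : {additive U -> U'} :=
  HB.pack F (GRing.isZmodMorphism.Build U U' F FB).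

(** * Monomials as a basis of F(e), and degrees *)

Section Basis.
Variables (V : finType) (e : rel V) (se : connect_sym e).
Implicit Types (s t : state e) (w : seq V).

Definition monomial w : tqft e := [ffun s : state e => mon e w s].

(** One letter at the root of each circle labelled X, so that the monomial of this word is the basis
    element [s]. *)
Definition word s : seq V := [seq z <- enum V | roots e z && s z].

Lemma count_word s z : count (connect e z) (word s) = s z.
Proof.
rewrite count_filter (eq_count (a2 := fun y => s z && (y == fingraph.root e z))) => [|y /=].
  case: (s z) => /=; last by rewrite count_pred0.
  by rewrite -[count _ _]/(count_mem (fingraph.root e z) _) count_uniq_mem ?enum_uniq ?mem_enum.
apply/idP/idP => [/and3P[zy /eqP ry sy]|/andP[sz /eqP ->]].
  by rewrite (state_connect s zy) sy -ry (fingraph.rootP se zy) eqxx.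
by rewrite connect_root fingraph.roots_root // -(state_connect s (connect_root e z)).
Qed.

Lemma mon_word s t : mon e (word s) t = (s == t)%:Z.
Proof.
congr (nat_of_bool _)%:Z; apply/forallP/eqP => [st|-> z]; last by rewrite count_word.
apply/val_inj/ffunP => z; have := st z; rewrite count_word.
by case: (label s z) (label t z) => -[].
Qed.

Lemma monomial_sum (X : tqft e) : X = \sum_s monomial (word s) *~ X s.
Proof.
apply/ffunP => t; rewrite sum_ffunE (bigD1 t) //= big1 => [|s st].
  by rewrite ffunMzE mulrzz ffunE mon_word eqxx mul1r addr0.
by rewrite ffunMzE mulrzz ffunE mon_word (negPf st) mul0r.
Qed.

Lemma zmod_morphism_sum (U : zmodType) (F : tqft e -> U) X : GRing.zmod_morphism F ->
  F X = \sum_s F (monomial (word s)) *~ X s.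
Proof.
move=> FB; rewrite {1}[X]monomial_sum.
rewrite [LHS](raddf_sum (pack_additive FB)); apply: eq_bigr => s _.
exact: (raddfMz (pack_additive FB)).
Qed.

Lemma eq_zmod_morphism (U : zmodType) (F G : tqft e -> U) :
    GRing.zmod_morphism F -> GRing.zmod_morphism G ->
  (forall w, F (monomial w) = G (monomial w)) -> F =1 G.
Proof.
move=> FB GB FG X; rewrite (zmod_morphism_sum X FB) (zmod_morphism_sum X GB).
by apply: eq_bigr => s _; rewrite FG.
Qed.

Lemma mon_degree w t : mon e w t != 0 -> n_comp e [pred x | t x] = size w.
Proof.
rewrite /mon; case: forallP => // wt _.
transitivity (\sum_(r | roots e r) count (connect e r) w)%N.
  rewrite (eq_bigr _ (fun r _ => eqP (wt r))) /n_comp_mem -sum1_card.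
  rewrite [RHS](bigID (fun r => t r)) /= [X in _ = (_ + X)%N]big1 => [|r /andP[_ /negPf->] //].
  by rewrite addn0; apply/esym/eq_big => [r|r /andP[_ ->]].
elim: w {wt} => [|x w IH] /=; first by rewrite big1.
rewrite big_split IH /= (bigD1 (fingraph.root e x)) ?fingraph.roots_root //=.
rewrite big1 => [|r /andP[/eqP rr rx]].
  by rewrite se connect_root addn0.
by apply/eqP; rewrite eqb0; apply: contra rx => /(fingraph.rootP se) <-; rewrite rr.
Qed.

(** The unit has degree minus the number of circles; each letter, and each factor X_p + X_q, adds
    2. *)
Lemma ev_degree L w t : ev e L w t != 0 ->
  state_degree t = ((size w + size L).*2)%:Z - (n_comp e predT)%:Z.
Proof.
elim: L w => [|pq L IH] w /=; last first.
  have [->|/IH -> _] := eqVneq (ev e L (pq.1 :: w) t) 0; last by rewrite addnS.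
  by rewrite add0r => /IH ->; rewrite addnS.
move=> /mon_degree wt; rewrite /state_degree (n_compC [pred x | t x]) wt.
rewrite (@eq_n_comp_r _ e [pred x | ~~ t x] [predC [pred x | t x]]) //.
by move: (n_comp _ _) => k; rewrite addn0 -addnn !PoszD opprD addrACA subrr add0r.
Qed.

Lemma state_degree_word s :
  state_degree s = ((size (word s)).*2)%:Z - (n_comp e predT)%:Z.
Proof. by rewrite (@ev_degree [::] (word s)) ?addn0 //= mon_word eqxx. Qed.

End Basis.

(** * Associativity, units and degrees of the product of blocks *)

Section Multiplication.
Variable n : nat.
Implicit Types (a b c d : matching n) (w : seq (point n)).

Lemma W_connect_sym b a : connect_sym (W b a). Proof. exact: W_sym. Qed.

Lemma saddle_zmod_morphism (V : finType) (e e' : rel V) p q p' :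
  GRing.zmod_morphism (@saddle V e e' p q p').
Proof.
move=> x y; apply/ffunP => t; rewrite !ffunE -sumrB; apply: eq_bigr => s _.
by rewrite !ffunE mulrBl.
Qed.

Lemma saddles_zmod_morphism c b a l S :
  GRing.zmod_morphism (@saddles n c b a l S).
Proof.
elim: l S => //= i l IH S x y; rewrite -IH; congr saddles.
exact: saddle_zmod_morphism.
Qed.

Lemma mult_subl c b a (Y : tqft (W b a)) : GRing.zmod_morphism (fun X : tqft (W c b) => mult X Y).
Proof.
move=> X X'; apply/ffunP => t; rewrite !ffunE (_ : juxtapose _ _ =
  juxtapose X Y - juxtapose X' Y) ?saddles_zmod_morphism ?ffunE //.
by apply/ffunP => s; rewrite !ffunE mulrBl.
Qed.

Lemma mult_subr c b a (X : tqft (W c b)) : GRing.zmod_morphism (@mult n c b a X).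
Proof.
move=> Y Y'; apply/ffunP => t; rewrite !ffunE (_ : juxtapose _ _ =
  juxtapose X Y - juxtapose X Y') ?saddles_zmod_morphism ?ffunE //.
by apply/ffunP => s; rewrite !ffunE mulrBr.
Qed.

Definition evs c a L w : tqft (W c a) := [ffun s : state (W c a) => ev (W c a) L w s].

Lemma evs_cons c a pq L w : evs c a (pq :: L) w = evs c a L (pq.1 :: w) + evs c a L (pq.2 :: w).
Proof. by apply/ffunP => s; rewrite !ffunE. Qed.

Lemma mult_evl c b a L w1 w2 :
  mult (evs c b L w1) (monomial (W b a) w2) = evs c a (L ++ split_factor c b a) (w1 ++ w2).
Proof.
elim: L w1 => [|pq L IH] w1; first exact: mult_mon.
rewrite !evs_cons -!cat_cons -!IH; move: (evs c b L _) (evs c b L _) => X X'.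
exact: (raddfD (pack_additive (mult_subl (monomial (W b a) w2)))).
Qed.

Lemma mult_evr c b a L w1 w2 :
  mult (monomial (W c b) w1) (evs b a L w2) = evs c a (L ++ split_factor c b a) (w1 ++ w2).
Proof.
elim: L w2 => [|pq L IH] w2; first exact: mult_mon.
rewrite evs_cons; set X := monomial _ _.
transitivity (mult X (evs b a L (pq.1 :: w2)) + mult X (evs b a L (pq.2 :: w2))).
  exact: (raddfD (pack_additive (@mult_subr c b a X))).
rewrite !IH; apply/ffunP => s; rewrite !ffunE /=.
by congr +%R; apply: ev_perm; rewrite -cat_rcons -(cat1s _ (w1 ++ w2)) catA perm_cat2r perm_rcons.
Qed.

(** Both sides are additive in each argument, so monomials suffice; there the words agree and the
    factors are compared by [split_factorA]. *)
Lemma multA d c b a (X : tqft (W d c)) (Y : tqft (W c b)) (Z : tqft (W b a)) :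
  mult (mult X Y) Z = mult X (mult Y Z).
Proof.
have EX (F G : tqft (W d c) -> tqft (W d a)) :=
  eq_zmod_morphism (W_connect_sym d c) (F := F) (G := G).
have EY (F G : tqft (W c b) -> tqft (W d a)) :=
  eq_zmod_morphism (W_connect_sym c b) (F := F) (G := G).
have EZ (F G : tqft (W b a) -> tqft (W d a)) :=
  eq_zmod_morphism (W_connect_sym b a) (F := F) (G := G).
apply: (EX (fun X => mult (mult X Y) Z) (fun X => mult X (mult Y Z))) X => [x x'|x x'|w1].
- by rewrite !mult_subl.
- by rewrite mult_subl.
apply: (EY (fun Y => mult (mult _ Y) Z) (fun Y => mult _ (mult Y Z))) Y => [x x'|x x'|w2].
- by rewrite mult_subr mult_subl.
- by rewrite mult_subl mult_subr.
apply: (EZ (fun Z => mult _ Z) (fun Z => mult _ (mult _ Z))) Z => [x x'|x x'|w3].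
- by rewrite mult_subr.
- by rewrite !mult_subr.
have := @mult_evr c b a [::] w2 w3; rewrite -[evs b a [::] w3]/(monomial _ _) => ->.
have := @mult_evr d c b [::] w1 w2; rewrite -[evs c b [::] w2]/(monomial _ _) => ->.
rewrite mult_evl mult_evr -catA; apply/ffunP => s; rewrite !ffunE.
rewrite -[(w1 ++ w2) ++ w3]catA; exact: split_factorA.
Qed.

(** Each circle contains its root and the far end of an arc at the root, hence at most n circles on
    2n points. With n circles these are the only points, so the arcs of [a] and of [b] at a non-root
    both end at the root. *)
Lemma n_comp_W b a : (n_comp (W b a) predT <= n)%N /\
  (n_comp (W b a) predT = n -> b = a).
Proof.
have se := W_connect_sym b a; set e := W b a in se *.
pose R := [set x | roots e x].
have RN : n_comp e predT = #|R|.
  by apply: eq_card => x; rewrite !inE andbT.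
have img (m : matching n) : (forall x, connect e x (m x)) -> R :&: m @: R = set0.
  move=> em; apply/setP => x; rewrite !inE; apply/negP => /andP[/eqP rx /imsetP[y]].
  rewrite inE => /eqP ry E; case/eqP: (arc_neq m y); rewrite -E.
  by transitivity (fingraph.root e x); rewrite // -[RHS]ry; apply/(fingraph.rootP se); rewrite E se.
have card (m : matching n) : (forall x, connect e x (m x)) -> #|R :|: m @: R| = (#|R|.*2)%N.
  move=> em; rewrite cardsU img // cards0 subn0 card_imset ?addnn //.
  exact: inv_inj (arcK m).
have eb x : connect e x (b x) by exact: connect_gluel.
have ea x : connect e x (a x) by exact: connect_gluer.
have le := card a ea; have := max_card [in R :|: a @: R]; rewrite le card_ord => leN.
split; first by rewrite RN; move: leN; move: #|R| => k; clear; lia.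
rewrite RN => RnE.
have full (m : matching n) : (forall x, connect e x (m x)) ->
    forall x, x \notin R -> m x = fingraph.root e x.
  move=> em x xR; have : x \in R :|: m @: R.
    suff -> : R :|: m @: R = setT by rewrite inE.
    by apply/eqP; rewrite eqEcard subsetT cardsT card_ord card // RnE -mul2n leqnn.
  rewrite inE (negPf xR) /= => /imsetP[y]; rewrite inE => /eqP ry ->.
  by rewrite arcK -[LHS]ry; apply/(fingraph.rootP se); exact: em.
have E (x : point n) : x \notin R -> b x = a x by move=> xR; rewrite !full.
apply/val_inj/ffunP => x; case xR: (x \in R); last by apply: E; rewrite xR.
have ax : a x \notin R.
  apply/negP => aR; have : a x \in R :&: a @: R by rewrite inE aR imset_f.
  by rewrite img // inE.
by have := E _ ax; rewrite arcK => {1}<-; rewrite arcK.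
Qed.

Lemma n_comp_Wd a : n_comp (W a a) predT = n.
Proof.
have se := W_connect_sym a a; set e := W a a in se *.
pose R := [set x | roots e x].
have RN : n_comp e predT = #|R|.
  by apply: eq_card => x; rewrite !inE andbT.
have [le _] := n_comp_W a a; apply/eqP; rewrite eqn_leq le /= RN.
have cE x y : connect e x y -> y = x \/ y = a x.
  have cl : closed e [pred z | (z == x) || (z == a x)].
    apply: intro_closed => // u v; rewrite /e /W /glue orbb => /eqP <-; rewrite !inE.
    by case/orP => /eqP ->; rewrite ?arcK eqxx ?orbT.
  by move/(closed_connect cl); rewrite !inE eqxx /= => /esym/orP[] /eqP; [left|right].
have : (#|R :|: a @: R| <= #|R| + #|a @: R|)%N by rewrite cardsU leq_subr.
rewrite card_imset; last exact: inv_inj (arcK a).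
suff -> : R :|: a @: R = setT by rewrite cardsT card_ord addnn -mul2n leq_pmul2l.
apply/setP => x; rewrite !inE; have [//|rx /=] := boolP (roots e x).
apply/imsetP; exists (fingraph.root e x); first by rewrite inE fingraph.roots_root.
by case: (cE _ _ (connect_root e x)) => E; rewrite E ?arcK //; case/negP: rx; rewrite /roots E.
Qed.

(* By the circle count, the cobordism only merges circles. *)
Lemma split_factor_diagl b a : split_factor b b a = [::].
Proof.
apply: size0nil; have := split_factor_n_comp b b a; rewrite n_comp_Wd.
move: (n_comp _ _) (size _) => k l; clear; lia.
Qed.

Lemma split_factor_diagr b a : split_factor b a a = [::].
Proof.
apply: size0nil; have := split_factor_n_comp b a a; rewrite n_comp_Wd.
move: (n_comp _ _) (size _) => k l; clear; lia.
Qed.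

Lemma mult_1l b a (Y : tqft (W b a)) : mult (monomial (W b b) [::]) Y = Y.
Proof.
move: Y; apply: (eq_zmod_morphism (W_connect_sym b a)) => [|x y //|w]; first exact: mult_subr.
by rewrite (@mult_evr b b a [::]) split_factor_diagl.
Qed.

Lemma mult_1r b a (X : tqft (W b a)) : mult X (monomial (W a a) [::]) = X.
Proof.
move: X; apply: (eq_zmod_morphism (W_connect_sym b a)) => [|x y //|w]; first exact: mult_subl.
by rewrite (@mult_evl b a a [::]) split_factor_diagr !cats0.
Qed.

Lemma mult_sum c b a (X : tqft (W c b)) (Y : tqft (W b a)) t :
  mult X Y t = \sum_s \sum_s' X s * Y s' * ev (W c a) (split_factor c b a) (word s ++ word s') t.
Proof.
rewrite (zmod_morphism_sum (W_connect_sym c b) X (mult_subl Y)) sum_ffunE.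
apply: eq_bigr => s _; rewrite ffunMzE mulrzz.
rewrite (zmod_morphism_sum (W_connect_sym b a) Y (@mult_subr c b a _)) sum_ffunE.
rewrite mulr_suml; apply: eq_bigr => s' _; rewrite ffunMzE mulrzz.
have -> := @mult_evl c b a [::] (word s) (word s').
by rewrite ffunE [LHS]mulrC (mulrC (ev _ _ _ _)) mulrA.
Qed.

Definition norm_degree b a (s : state (W b a)) : int := state_degree s + n%:Z.

Lemma norm_degree_ge0 b a (s : state (W b a)) : 0 <= norm_degree s.
Proof.
rewrite /norm_degree (state_degree_word (W_connect_sym b a)); have [le _] := n_comp_W b a.
move: le (size _); move: (n_comp _ _) => k le l; clear -le; lia.
Qed.

(** The degree is twice the number of letters plus n minus the number of circles; both contributions
    are nonnegative. *)
Lemma norm_degree_eq0 b a (s : state (W b a)) :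
  norm_degree s = 0 -> b = a /\ word s = [::].
Proof.
rewrite /norm_degree (state_degree_word (W_connect_sym b a)); have [le eq] := n_comp_W b a => E.
suff [/eq ? /size0nil ?] : n_comp (W b a) predT = n /\ size (word s) = 0%N by [].
move: le E {eq}; move: (size _) (n_comp _ _) => l k le E; clear -le E; lia.
Qed.

(** Each splitting adds 2 to the degree, which the circle count compensates; the shift by n absorbs
    the n saddles. *)
Lemma ev_norm_degree c b a (s : state (W c b)) (s' : state (W b a)) (t : state (W c a)) :
  ev (W c a) (split_factor c b a) (word s ++ word s') t != 0 ->
  norm_degree t = norm_degree s + norm_degree s'.
Proof.
move=> /(ev_degree (W_connect_sym c a)); rewrite /norm_degree => ->.
rewrite !(state_degree_word (W_connect_sym _ _)) size_cat.
have := split_factor_n_comp c b a.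
move: (n_comp _ _) (n_comp _ _) (n_comp _ _) (size (word s)) (size (word s')) (size _).
clear => k1 k2 k3 l1 l2 l3; lia.
Qed.

End Multiplication.

(** * The arc ring *)

Section ArcRing.
Variable n : nat.
Implicit Types (a b c : matching n) (h k x y : H n) (u v : basis n).

Definition state_index b a (s : state (W b a)) : basis n :=
  existT (fun ba => state (W ba.1 ba.2)) (b, a) s.

Lemma blockE x b a s : block x b a s = x (state_index s).
Proof. by rewrite ffunE. Qed.

Lemma eq_blocks x y : (forall b a, block x b a = block y b a) -> x = y.
Proof.
move=> E; apply/ffunP => -[[b a] s]; have := congr1 (fun X : tqft _ => X s) (E b a).
by rewrite !blockE.
Qed.

Lemma block_mul x y b a : block (H_mul x y) b a = \sum_c mult (block x b c) (block y c a).
Proof. by apply/ffunP => s; rewrite blockE ffunE. Qed.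

Lemma blockB x y b a : block (x - y) b a = block x b a - block y b a.
Proof. by apply/ffunP => s; rewrite !ffunE. Qed.

Lemma H_mulBl y : GRing.zmod_morphism (fun x => H_mul x y).
Proof.
move=> x x'; apply: eq_blocks => b a; rewrite blockB !block_mul -sumrB.
by apply: eq_bigr => c _; rewrite blockB mult_subl.
Qed.

Lemma H_mulBr x : GRing.zmod_morphism (H_mul x).
Proof.
move=> y y'; apply: eq_blocks => b a; rewrite blockB !block_mul -sumrB.
by apply: eq_bigr => c _; rewrite blockB mult_subr.
Qed.

Lemma H_mulDl x x' y : H_mul (x + x') y = H_mul x y + H_mul x' y.
Proof. exact: (raddfD (pack_additive (H_mulBl y))). Qed.

Lemma H_mulDr x y y' : H_mul x (y + y') = H_mul x y + H_mul x y'.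
Proof. exact: (raddfD (pack_additive (H_mulBr x))). Qed.

Lemma H_mulA x y z : H_mul (H_mul x y) z = H_mul x (H_mul y z).
Proof.
apply: eq_blocks => b a; rewrite !block_mul.
transitivity (\sum_c \sum_d mult (mult (block x b d) (block y d c)) (block z c a)).
  apply: eq_bigr => c _; rewrite block_mul.
  exact: (raddf_sum (pack_additive (mult_subl (block z c a)))).
rewrite exchange_big; apply: eq_bigr => d _; rewrite block_mul.
under eq_bigr => c _ do rewrite multA.
by apply/esym/(raddf_sum (pack_additive (@mult_subr n b d a (block x b d)))).
Qed.

Lemma mult0l c b a (Y : tqft (W b a)) : mult (0 : tqft (W c b)) Y = 0.
Proof. exact: (raddf0 (pack_additive (mult_subl Y))). Qed.

Lemma block_one b a : block (H_one n) b a = if b == a then monomial (W b a) [::] else 0.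
Proof.
apply/ffunP => s; rewrite !ffunE /=; case: eqP => [E|_]; rewrite !ffunE //=.
congr (nat_of_bool _)%:Z; apply: eq_forallb => i; by case: (s i).
Qed.

Lemma H_mul1l x : H_mul (H_one n) x = x.
Proof.
apply: eq_blocks => b a; rewrite block_mul (bigD1 b) //= big1 => [|c cb].
  by rewrite block_one eqxx mult_1l addr0.
by rewrite block_one eq_sym (negPf cb) mult0l.
Qed.

Lemma H_mul1r x : H_mul x (H_one n) = x.
Proof.
apply: eq_blocks => b a; rewrite block_mul (bigD1 a) //= big1 => [|c ca].
  by rewrite block_one eqxx mult_1r addr0.
by rewrite block_one (negPf ca) mult_0r.
Qed.

Definition hdeg u : int := norm_degree (tagged u).

Lemma H_homog_mul i j x y : H_homog i x -> H_homog j y -> H_homog (i + j) (H_mul x y).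
Proof.
move=> xi yj [[c a] t]; rewrite -[_ + n%:Z]/(norm_degree t).
rewrite -[H_mul x y _]/(H_mul x y (state_index t)) -blockE block_mul sum_ffunE => nz.
have [b] : exists b, mult (block x c b) (block y b a) t != 0.
  apply/existsP; apply: contraNT nz => /existsPn z; rewrite big1 // => b _.
  by apply/eqP; have := z b; rewrite negbK.
rewrite mult_sum => nz'.
have /existsP[s /existsP[s' nz2]] : [exists s, exists s', block x c b s * block y b a s' *
    ev (W c a) (split_factor c b a) (word s ++ word s') t != 0].
  apply: contraNT nz' => /existsPn z; rewrite big1 // => s _; rewrite big1 // => s' _.
  by have /existsPn/(_ s') := z s; rewrite negbK => /eqP.
move: nz2; rewrite !mulf_eq0 !negb_or !blockE => /andP[/andP[/xi <- /yj <-]].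
by move=> /ev_norm_degree ->.
Qed.

Lemma unit_state_subproof a : [forall i, forall j, W a a i j ==>
  ([ffun _ : point n => false] i == [ffun _ => false] j)].
Proof. by apply/forallP => i; apply/forallP => j; rewrite !ffunE implybT. Qed.

Definition unit_index a : basis n := state_index (State (unit_state_subproof a)).

Definition idem a : H n := [ffun u : basis n =>
  [&& (tag u).1 == a, (tag u).2 == a & [forall i, ~~ tagged u i]]%:Z].

Lemma idemE a u : idem a u = (u == unit_index a)%:Z.
Proof.
rewrite ffunE; congr (nat_of_bool _)%:Z; apply/and3P/eqP => [|->]; last first.
  by split=> //=; apply/forallP => i; rewrite ffunE.
case: u => [[b c] s] /= [/eqP ba /eqP ca]; case: _ / (esym ba) s => s.
case: _ / (esym ca) s => s /forallP s0; congr state_index; apply/val_inj/ffunP => i.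
by rewrite !ffunE; apply/negbTE/s0.
Qed.

Lemma hdeg_ge0 u : 0 <= hdeg u. Proof. exact: norm_degree_ge0. Qed.

Lemma hdeg_unit a : hdeg (unit_index a) = 0.
Proof.
rewrite /hdeg /norm_degree (state_degree_word (W_connect_sym a a)) n_comp_Wd.
rewrite size_filter (eq_count (a2 := pred0)) ?count_pred0 ?add0r ?addNr // => i.
by rewrite /= ffunE andbF.
Qed.

Lemma norm_degree0_false a (s : state (W a a)) : norm_degree s = 0 ->
  s = State (unit_state_subproof a).
Proof.
move=> /norm_degree_eq0[_ w0]; apply/val_inj/ffunP => i; rewrite !ffunE.
have := count_word (W_connect_sym a a) s i; rewrite w0.
by rewrite -[val s i]/(s i); case: (s i).
Qed.

Lemma hdeg_eq0 u : hdeg u = 0 -> u = unit_index (tag u).2.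
Proof.
case: u => [[b a] s]; rewrite /hdeg /= => d0; have [ba _] := norm_degree_eq0 d0.
by case: _ / ba s d0 => s /norm_degree0_false ->.
Qed.

Lemma idem_proj a : idem a \in in_proj a.
Proof. by apply/in_projP => u /negPf ua; rewrite ffunE ua andbF. Qed.

Lemma H_homog0_idem a x : x \in in_proj a -> H_homog 0 x -> x = idem a *~ x (unit_index a).
Proof.
move=> /in_projP xa x0; apply/ffunP => u; rewrite ffunMzE mulrzz idemE.
have [->|ne] := eqVneq u (unit_index a); first by rewrite mul1r.
rewrite mul0r; apply: contraNeq ne => xu; have d0 := x0 _ xu.
rewrite (hdeg_eq0 d0); apply/eqP; congr unit_index.
by apply/eqP; apply: contraNT xu => /xa ->.
Qed.

Lemma block_idem c b a : block (idem c) b a =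
  if (b == c) && (a == c) then monomial (W b a) [::] else 0.
Proof.
apply/ffunP => s; rewrite blockE ffunE /= andbA; case: ifP => _; rewrite ffunE //=.
by congr (nat_of_bool _)%:Z; apply: eq_forallb => i; case: (s i).
Qed.

Lemma H_mul_idem a x : x \in in_proj a -> H_mul x (idem a) = x.
Proof.
move=> /in_projP xa; apply: eq_blocks => b c; rewrite block_mul (bigD1 c) //=.
rewrite big1 => [|d dc]; last first.
  rewrite block_idem; case: ifP => [/andP[/eqP da /eqP ca]|_]; last exact: mult_0r.
  by move: dc; rewrite da ca eqxx.
rewrite block_idem andbb addr0; case: eqP => [_|/eqP ca]; first exact: mult_1r.
rewrite mult_0r; apply/ffunP => s; rewrite blockE xa // ffunE //.
Qed.

(** Degrees add up and are nonnegative, so only the degree 0 part of [x] reaches [u], and that part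
    is a combination of the idempotents. This turns a coordinate of lowest degree into a module
    homomorphism to Z. *)
Lemma H_mul_lowest x y u : (forall v, hdeg v < hdeg u -> y v = 0) ->
  H_mul x y u = x (unit_index (tag u).1) * y u.
Proof.
case: u => [[c a] t] /= ylow.
rewrite -[H_mul x y _]/(H_mul x y (state_index t)) -blockE block_mul sum_ffunE.
have low b (X : tqft (W c b)) : (forall s, norm_degree s = 0 -> X s = 0) ->
    mult X (block y b a) t = 0.
  move=> X0; rewrite mult_sum big1 // => s _; rewrite big1 // => s' _.
  have [->|/ev_norm_degree E] :=
    eqVneq (ev (W c a) (split_factor c b a) (word s ++ word s') t) 0; first by rewrite mulr0.
  have [s0|s0] := eqVneq (norm_degree s) 0; first by rewrite X0 // !mul0r.
  rewrite blockE ylow ?mulr0 ?mul0r //; rewrite /hdeg /= -[ltRHS]/(norm_degree t) E.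
  by rewrite ltrDr Order.POrderTheory.lt_def s0 norm_degree_ge0.
rewrite (bigD1 c) //= big1 ?addr0 => [|b bc]; last first.
  by apply: low => s /norm_degree_eq0[cb]; rewrite cb eqxx in bc.
(* [X0] is the diagonal block of [x] without its degree 0 part, so [low] applies to it. *)
set z := x _; pose X0 := block x c c - monomial (W c c) [::] *~ z.
have -> : block x c c = X0 + monomial (W c c) [::] *~ z by rewrite subrK.
rewrite (_ : mult _ _ =
  mult X0 (block y c a) + mult (monomial (W c c) [::] *~ z) (block y c a)); last first.
  exact: (raddfD (pack_additive (mult_subl (block y c a)))).
rewrite ffunE low ?add0r => [|s /norm_degree0_false ->]; last first.
  rewrite !ffunE ffunMzE mulrzz ffunE /mon [X in X%:Z](_ : _ = 1%N) ?mul1r ?subrr //.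
  by apply/eqP; rewrite eqb1; apply/forallP => i; rewrite ffunE.
rewrite (_ : mult _ _ = mult (monomial (W c c) [::]) (block y c a) *~ z); last first.
  exact: (raddfMz (pack_additive (mult_subl (block y c a)))).
by rewrite mult_1l ffunMzE mulrzz blockE mulrC.
Qed.

End ArcRing.

(** * Graded modules *)

Section Modules.
Variable n : nat.
Implicit Types (a b : matching n) (h k : H n) (u v : basis n).

Section GradedTheory.
Variables (M : hact n) (gM : graded_module M).
Implicit Types x y : M.

Lemma act_subl x : GRing.zmod_morphism (fun h => act h x).
Proof. by move=> h k; apply/eqP; rewrite eq_sym subr_eq -act_addl // subrK. Qed.

Lemma act_subr h : GRing.zmod_morphism (@act n M h).
Proof. by move=> x y; apply/eqP; rewrite eq_sym subr_eq -act_addr // subrK. Qed.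

Lemma act0r h : act h (0 : M) = 0.
Proof. exact: (raddf0 (pack_additive (act_subr h))). Qed.

Lemma mhomogD i x y : mhomog i x -> mhomog i y -> mhomog i (x + y).
Proof.
move=> xi yi; rewrite -[y]opprK -[- y]sub0r; apply: mhomogB => //.
by apply: mhomogB => //; exact: mhomog0.
Qed.

Lemma mhomog_sum (I : Type) (r : seq I) (P : pred I) i (f : I -> M) :
  (forall j, P j -> mhomog i (f j)) -> mhomog i (\sum_(j <- r | P j) f j).
Proof.
by move=> fi; apply: big_ind => //; [exact: mhomog0|exact: mhomogD].
Qed.

(** The homogeneous components of given generators generate as well; homogeneity is what allows a
    grading-preserving cover by a free module. *)
Lemma homogeneous_generators : finitely_generated M ->
  exists (k : nat) (d : 'I_k -> int) (g : 'I_k -> M),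
    (forall l, mhomog (d l) (g l)) /\
    forall x, exists h : 'I_k -> H n, x = \sum_l act (h l) (g l).
Proof.
move=> [k [g gP]].
have /fin_all_exists[r /fin_all_exists[f fP]] := fun i => mhomog_span gM (g i).
pose G := [seq (i, j) | i <- enum 'I_k, j <- r i].
exists (size G), (fun l => (tnth (in_tuple G) l).2),
  (fun l => f (tnth (in_tuple G) l).1 (tnth (in_tuple G) l).2).
split=> [l|x]; first by have [fh _] := fP (tnth (in_tuple G) l).1; exact: fh.
have [h ->] := gP x; exists (fun l => h (tnth (in_tuple G) l).1).
rewrite -(big_tnth _ _ _ xpredT (fun p : 'I_k * int => act (h p.1) (f p.1 p.2))).
rewrite big_allpairs_dep big_enum /=; apply: eq_bigr => i _.
have [_ ->] := fP i; exact: (raddf_sum (pack_additive (act_subr (h i)))).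
Qed.

End GradedTheory.

(** A criterion for modules embedded in a power of Z whose coordinates each have a fixed degree: the
    grading axioms are then formal. It serves P_a{m}, the free modules and Z. *)
Lemma graded_of_coordinates (M : hact n) (I : finType) (co : I -> M -> int)
    (dg : I -> int) (pr : int -> M -> M) :
    (forall h k (x : M), act (h + k) x = act h x + act k x) ->
    (forall h (x y : M), act h (x + y) = act h x + act h y) ->
    (forall x : M, act (H_one n) x = x) ->
    (forall h k (x : M), act (H_mul h k) x = act h (act k x)) ->
    (forall i j h (x : M), H_homog i h -> mhomog j x -> mhomog (i + j) (act h x)) ->
    (forall j, GRing.zmod_morphism (co j)) ->
    (forall x : M, (forall j, co j x = 0) -> x = 0) ->
    (forall i (x : M), mhomog i x <-> (forall j, co j x != 0 -> dg j = i)) ->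
    (forall i (x : M) j, co j (pr i x) = if dg j == i then co j x else 0) ->
  graded_module M.
Proof.
move=> al ar a1 am ah coB co_inj mh prE.
have co0 j : co j 0 = 0 by exact: (raddf0 (pack_additive (coB j))).
have co_sum j (r : seq int) f : co j (\sum_(i <- r) f i) = \sum_(i <- r) co j (f i).
  exact: (raddf_sum (pack_additive (coB j))).
split=> //.
- by move=> i; apply/mh => j; rewrite co0 eqxx.
- move=> i x y /mh xi /mh yi; apply/mh => j; rewrite coB.
  have [->|/xi //] := eqVneq (co j x) 0; rewrite sub0r oppr_eq0; exact: yi.
(* Each degree is listed once, as a repetition would count a component twice. *)
- move=> x; exists (undup (map dg (enum I))), (fun i => pr i x); split.
    by move=> i; apply/mh => j; rewrite prE; have [|_] := eqVneq (dg j) i; rewrite ?eqxx.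
  apply/eqP; rewrite -subr_eq0; apply/eqP/co_inj => j; rewrite coB co_sum.
  rewrite (bigD1_seq (dg j)) ?undup_uniq //=; last first.
    by rewrite mem_undup map_f // mem_enum.
  rewrite prE eqxx big1 ?addr0 ?subrr // => i ij.
  by rewrite prE eq_sym (negPf ij).
move=> r f ur fh s0 i ir; apply: co_inj => j.
have other (k : int) : dg j != k -> co j (f k) = 0.
  by move=> jk; apply: contraNeq jk => /(proj1 (mh _ _) (fh k)) ->.
have [ji|/other //] := eqVneq (dg j) i.
have := congr1 (co j) s0; rewrite co0 co_sum (bigD1_seq i) //= big1 ?addr0 // => k ki.
by apply: other; rewrite ji eq_sym.
Qed.

Definition mkghom (M N : hact n) (f : M -> N) (fB : GRing.zmod_morphism f)
    (fact : forall h x, f (act h x) = act h (f x))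
    (fhomog : forall i x, mhomog i x -> mhomog i (f x)) : ghom M N :=
  @GHom n M N (pack_additive fB) fact fhomog.

Lemma surjective_epi (M N : fgmod n) (g : ghom M N) :
  (forall y, exists x, g x = y) -> epimorphism g.
Proof. by move=> gs L u v uv y; have [x <-] := gs y. Qed.

Definition idghom (M : hact n) : ghom M M :=
  @mkghom M M id (fun x y => erefl) (fun h x => erefl) (fun i x xi => xi).

Definition hpart (i : int) (x : H n) : H n := [ffun u => if hdeg u == i then x u else 0].

Lemma hpart_proj i a (x : H n) : x \in in_proj a -> hpart i x \in in_proj a.
Proof. by move=> /in_projP xa; apply/in_projP => u /xa xu; rewrite ffunE xu if_same. Qed.

Lemma proj_val_inj a : injective (@proj_val n a).
Proof. exact: val_inj. Qed.

Lemma shift_proj_graded a m : graded_module (shift m (proj a)).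
Proof.
apply: (@graded_of_coordinates (shift m (proj a)) _ (fun u x => proj_val x u)
  (fun u => hdeg u + m)
  (fun i x => ProjCar (hpart_proj (i - m) (proj_valP x)))) => /=.
- by move=> h k x; apply: proj_val_inj; exact: H_mulDl.
- by move=> h x y; apply: proj_val_inj; exact: H_mulDr.
- by move=> x; apply: proj_val_inj; exact: H_mul1l.
- by move=> h k x; apply: proj_val_inj; exact: H_mulA.
- by move=> i j h x hi xj; rewrite -addrA; exact: H_homog_mul.
- by move=> u x y; rewrite /= ffunE; rewrite ffunE.
- by move=> x x0; apply: proj_val_inj; apply/ffunP => u; rewrite x0 ffunE.
- move=> i x; split=> [xi u /xi E|xi u /xi <-]; last by rewrite addrK.
  by apply/eqP; rewrite eq_sym -subr_eq -E.
by move=> i x u; rewrite ffunE eq_sym subr_eq eq_sym.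
Qed.

Lemma shift_proj_fg a m : finitely_generated (shift m (proj a)).
Proof.
exists 1%N, (fun _ => ProjCar (idem_proj a)) => x; exists (fun _ => proj_val x).
rewrite big_ord1; apply: proj_val_inj; apply/esym/H_mul_idem; exact: proj_valP.
Qed.

Definition projmod a m : fgmod n := FgMod (shift_proj_graded a m) (shift_proj_fg a m).

Definition free_hact (k : nat) (d : 'I_k -> int) : hact n :=
  @HAct n {ffun 'I_k -> H n} (fun h x => [ffun l => H_mul h (x l)])
    (fun i x => forall l, H_homog (i - d l) (x l)).

Lemma free_graded (k : nat) (d : 'I_k -> int) : graded_module (free_hact d).
Proof.
apply: (@graded_of_coordinates (free_hact d) ('I_k * basis n)%type
  (fun p x => (x : {ffun 'I_k -> H n}) p.1 p.2) (fun p => hdeg p.2 + d p.1)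
  (fun i x => [ffun l => hpart (i - d l) ((x : {ffun 'I_k -> H n}) l)])) => /=.
- by move=> h h' x; apply/ffunP => l; rewrite !ffunE; exact: H_mulDl.
- by move=> h x y; apply/ffunP => l; rewrite !ffunE; exact: H_mulDr.
- by move=> x; apply/ffunP => l; rewrite !ffunE; exact: H_mul1l.
- by move=> h h' x; apply/ffunP => l; rewrite !ffunE; exact: H_mulA.
- by move=> i j h x hi xj l; rewrite ffunE -addrA; exact: H_homog_mul.
- by move=> p x y; rewrite /= !ffunE.
- by move=> x x0; apply/ffunP => l; apply/ffunP => u; rewrite (x0 (l, u)) !ffunE.
- move=> i x; split=> [xi [l u] /= /(xi l) E|xi l u xu].
    by apply/eqP; rewrite eq_sym -subr_eq -E.
  by have /= <- := xi (l, u) xu; rewrite addrK.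
by move=> i x [l u] /=; rewrite !ffunE eq_sym subr_eq eq_sym.
Qed.

Lemma free_fg (k : nat) (d : 'I_k -> int) : finitely_generated (free_hact d).
Proof.
exists k, (fun l => [ffun l' => if l == l' then H_one n else 0]) => x.
exists (fun l => (x : {ffun 'I_k -> H n}) l); apply/ffunP => l.
rewrite sum_ffunE (bigD1 l) //= !ffunE eqxx H_mul1r big1 ?addr0 // => l' nl.
by rewrite !ffunE (negPf nl); exact: (raddf0 (pack_additive (H_mulBr _))).
Qed.

Definition freemod (k : nat) (d : 'I_k -> int) : fgmod n := FgMod (free_graded d) (free_fg d).

(* H^n acts on Z through its quotient by the elements of positive degree and by
   the idempotents other than that of a. *)
Definition simple_hact a (m : int) : hact n :=
  @HAct n int (fun h z => h (unit_index a) * z) (fun i z => z != 0 -> m = i).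

Lemma mul_unit_coef a h k :
  H_mul h k (unit_index a) = h (unit_index a) * k (unit_index a).
Proof.
by rewrite H_mul_lowest // => v; rewrite hdeg_unit ltNge hdeg_ge0.
Qed.

Lemma unit_coef_homog a i h : H_homog i h -> h (unit_index a) != 0 -> i = 0.
Proof. by move=> hi /hi <-; exact: hdeg_unit. Qed.

Lemma simple_graded a m : graded_module (simple_hact a m).
Proof.
apply: (@graded_of_coordinates (simple_hact a m) unit
  (fun _ z => z : int) (fun _ => m) (fun i z => if m == i then z else 0)) => //=.
- by move=> h k x; rewrite ffunE mulrDl.
- by move=> h x y; rewrite mulrDr.
- move=> x; rewrite ffunE eqxx /= (_ : [forall i, _]) ?mul1r //.
  by apply/forallP => i; rewrite ffunE.
- by move=> h k x; rewrite mul_unit_coef mulrA.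
- move=> i j h x hi xj; rewrite mulf_eq0 negb_or => /andP[/(unit_coef_homog hi) -> /xj ->].
  by rewrite add0r.
- by move=> x /(_ tt).
by move=> i x; split=> [xi _ //|/(_ tt)].
Qed.

Lemma simple_fg a m : finitely_generated (simple_hact a m).
Proof.
exists 1%N, (fun _ => 1 : int) => x; exists (fun _ => idem a *~ x).
rewrite big_ord1 /= ffunMzE idemE eqxx.
by rewrite mulrzz mul1r mulr1.
Qed.

Definition simplemod a m : fgmod n := FgMod (simple_graded a m) (simple_fg a m).

End Modules.

(** * Splitting off a retract *)

Section Kernel.
Variables (n : nat) (M N : fgmod n) (f : ghom M N).

Definition ker_pred : {pred M} := [pred x | f x == 0].

Lemma ker_pred_zmod_closed : zmod_closed ker_pred.
Proof.
split=> [|x y]; rewrite !inE ?raddf0 // => /eqP fx /eqP fy.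
by rewrite raddfB fx fy subrr.
Qed.

HB.instance Definition _ :=
  GRing.isZmodClosed.Build M ker_pred ker_pred_zmod_closed.

Record ker_car := KerCar { ker_val :> M; ker_valP : ker_val \in ker_pred }.

HB.instance Definition _ := [isSub for ker_val].
HB.instance Definition _ := [Choice of ker_car by <:].
HB.instance Definition _ := [SubChoice_isSubZmodule of ker_car by <:].

Lemma ker_act_subproof h (x : ker_car) : act h (ker_val x) \in ker_pred.
Proof.
have := ker_valP x; rewrite !inE => /eqP fx; rewrite ghom_act fx.
by rewrite act0r //; exact: fgmod_graded.
Qed.

Definition ker_hact : hact n :=
  @HAct n ker_car (fun h x => KerCar (ker_act_subproof h x))
    (fun i x => mhomog i (ker_val x)).

Section Split.
Variables (g : ghom N M) (gK : cancel g f).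

Lemma ker_proj_subproof x : x - g (f x) \in ker_pred.
Proof. by rewrite inE raddfB gK subrr. Qed.

Definition ker_proj x : ker_car := KerCar (ker_proj_subproof x).

Lemma ker_projB : GRing.zmod_morphism ker_proj.
Proof. by move=> x y; apply: val_inj; rewrite /= !raddfB addrACA. Qed.

Lemma ker_projE (x : ker_car) : ker_proj (ker_val x) = x.
Proof.
apply: val_inj => /=; have := ker_valP x; rewrite inE => /eqP ->.
by rewrite raddf0 subr0.
Qed.

Lemma ker_proj_act h x : ker_proj (act h x) = act h (ker_proj x : ker_hact).
Proof.
apply: val_inj; rewrite /= !ghom_act.
exact/esym/(act_subr (fgmod_graded M)).
Qed.

Lemma ker_proj_homog i x : mhomog i x -> mhomog i (ker_proj x : ker_hact).
Proof.
move=> xi; apply: (mhomogB (fgmod_graded M)) => //.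
by do 2!apply: ghom_homog.
Qed.

Lemma ker_graded : graded_module ker_hact.
Proof.
have gM := fgmod_graded M.
have sumE (r : seq int) (F : int -> ker_car) :
  ker_val (\sum_(i <- r) F i) = \sum_(i <- r) ker_val (F i) by exact: (raddf_sum val).
split.
- by move=> h k x; apply: val_inj; exact: act_addl.
- by move=> h x y; apply: val_inj; exact: act_addr.
- by move=> x; apply: val_inj; exact: act_one.
- by move=> h k x; apply: val_inj; exact: act_mul.
- by move=> i; exact: (mhomog0 gM).
- by move=> i x y; exact: (mhomogB gM).
- by move=> i j h x; exact: (mhomog_act gM).
- move=> x; have [r [F [Fh xE]]] := mhomog_span gM (ker_val x).
  exists r, (fun i => ker_proj (F i)); split=> [i|]; first exact: ker_proj_homog.
  by rewrite -{1}[x]ker_projE xE; exact: (raddf_sum (pack_additive ker_projB)).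
move=> r F ur Fh s0 i ir; apply: val_inj => /=.
apply: (mhomog_free gM (f := fun i => ker_val (F i)) ur) => //.
by rewrite -sumE s0.
Qed.

(** The section makes the kernel a quotient of [M] through [ker_proj], so generators of [M] project
    to generators. *)
Lemma ker_fg : finitely_generated ker_hact.
Proof.
have [k [e eP]] := fgmod_fg M; exists k, (fun l => ker_proj (e l)) => x.
have [h xE] := eP (ker_val x); exists h; rewrite -{1}[x]ker_projE xE.
transitivity (\sum_(l < k) ker_proj (act (h l) (e l))).
  exact: (raddf_sum (pack_additive ker_projB)).
by apply: eq_bigr => l _; rewrite ker_proj_act.
Qed.

Definition kermod : fgmod n := FgMod ker_graded ker_fg.

Lemma split_isomorphic : isomorphic M (dsum N kermod).
Proof.
have FB : GRing.zmod_morphism (fun x : M => (f x, ker_proj x) : dsum N kermod).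
  by move=> x y; rewrite raddfB ker_projB.
have GB : GRing.zmod_morphism (fun p : dsum N kermod => g p.1 + ker_val p.2 : M).
  by move=> [x x'] [y y'] /=; rewrite raddfB opprD addrACA.
exists (@mkghom n M (dsum N kermod) _ FB
  (fun h x => congr2 pair (ghom_act f h x) (ker_proj_act h x))
  (fun i x xi => conj (ghom_homog f xi) (ker_proj_homog xi))).
have Gact h (p : dsum N kermod) : g (act h p).1 + ker_val (act h p).2 =
    act h (g p.1 + ker_val p.2).
  by rewrite act_addr ?ghom_act //; exact: fgmod_graded.
have Gh i (p : dsum N kermod) : mhomog i p -> mhomog i (g p.1 + ker_val p.2).
  by move=> [h1 h2]; apply: (mhomogD (fgmod_graded M)) => //; exact: ghom_homog.
exists (@mkghom n (dsum N kermod) M _ GB Gact Gh); split=> [x|[y z]] /=.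
  by rewrite addrC subrK.
have fz : f (ker_val z) = 0 by have := ker_valP z; rewrite inE => /eqP.
congr pair; first by rewrite raddfD gK fz addr0.
by apply: val_inj; rewrite /= raddfD gK fz addr0 addrC addKr.
Qed.

End Split.

End Kernel.

Lemma retract_of_indecomposable n (M N : fgmod n) (f : ghom M N) (g : ghom N M) :
  cancel g f -> indecomposable M -> ~ is_zero N -> isomorphic M N.
Proof.
move=> gK [_ indM] nN; have [//|K0] := indM _ _ (split_isomorphic gK).
exists f, g; split=> // x.
have := congr1 (@ker_val _ _ _ _) (K0 (ker_proj gK x)) => /= /eqP.
by rewrite subr_eq0 => /eqP.
Qed.

(** Descent on the number of indices of smaller degree. Excluded middle is used because [Q] will
    quantify over the elements of a module. *)
Lemma exists_minimal (I : finType) (Q : I -> Prop) (dg : I -> int) :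
  (exists i, Q i) -> exists i, Q i /\ forall j, Q j -> dg i <= dg j.
Proof.
case=> i; have [N] := ubnP #|[pred j | dg j < dg i]|; elim: N i => // N IH i iN Qi.
have [[j [Qj ji]]|no] := classic (exists j, Q j /\ dg j < dg i); last first.
  exists i; split=> // j Qj; rewrite leNgt; apply/negP => ji; apply: no; by exists j.
apply: (IH j _ Qj); apply: leq_trans (ltnSE iN); apply/proper_card/properP; split.
  by apply/subsetP => k; rewrite !inE => /lt_trans; apply.
by exists j; rewrite inE // ltxx.
Qed.

(** The least positive value of [F] divides every other: the remainder is again a value of [F]. *)
Lemma divide_by_gcd (U : zmodType) (F : U -> int) :
    GRing.zmod_morphism F -> (exists x, F x != 0) ->
  exists d, d != 0 /\ (forall x, (d %| F x)%Z) /\ exists x, F x = d.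
Proof.
move=> FB [x0 nz]; pose Fa := pack_additive FB.
have [N [[x [N0 FxN]] minN]] : exists N : nat, (exists x, N != 0%N /\ F x = N%:Z) /\
    forall k : nat, (exists x, k != 0%N /\ F x = k%:Z) -> (N <= k)%N.
  have [k kN] : exists k : nat, exists x, k != 0%N /\ F x = k%:Z.
    exists `|F x0|%N; rewrite absz_eq0 /=; have [F0|F0] := leP 0 (F x0).
      by exists x0; rewrite gez0_abs.
    by exists (- x0); split; rewrite // ltz0_abs //; exact: (raddfN Fa).
  have [m] := ubnP k; elim: m k kN => // m IH k kN km.
  have [[j [jN jk]]|no] := classic (exists j : nat,
    (exists x, j != 0%N /\ F x = j%:Z) /\ (j < k)%N).
    by apply: (IH j) => //; exact: leq_trans jk (ltnSE km).
  exists k; split=> // j jN; rewrite leqNgt; apply/negP => jk; apply: no; by exists j.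
exists N%:Z; split; first by rewrite eqz_nat.
split; last by exists x.
move=> y; apply/dvdzP; exists (F y %/ N%:Z)%Z.
have r0 : 0 <= (F y %% N%:Z)%Z by rewrite modz_ge0.
have rN : (F y %% N%:Z)%Z < N%:Z by rewrite ltz_pmod // ltz_nat lt0n.
rewrite {1}(divz_eq (F y) N%:Z); suff -> : (F y %% N%:Z)%Z = 0 by rewrite addr0.
apply/eqP; apply: contraTT rN => nr; rewrite -leNgt.
have E : F (y - x *~ (F y %/ N%:Z)%Z) = (F y %% N%:Z)%Z.
  rewrite FB [X in _ - X](raddfMz Fa) /= FxN mulrzz mulrC {1}(divz_eq (F y) N%:Z).
  by rewrite addrAC subrr add0r.
have := minN `|(F y %% N%:Z)%Z|%N; rewrite -lez_nat gez0_abs //; apply.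
by exists (y - x *~ (F y %/ N%:Z)%Z); split; rewrite ?absz_eq0 // E gez0_abs.
Qed.

Section Cover.
Variables (n : nat) (M : fgmod n) (k : nat) (d : 'I_k -> int) (g : 'I_k -> M).
Hypothesis gh : forall l, mhomog (d l) (g l).

Definition cover_fun (x : freemod n d) : M :=
  \sum_l act ((x : {ffun 'I_k -> H n}) l) (g l).

Lemma cover_funB : GRing.zmod_morphism cover_fun.
Proof.
move=> x y; rewrite /cover_fun -sumrB; apply: eq_bigr => l _.
by rewrite !ffunE; exact: (act_subl (fgmod_graded M)).
Qed.

Lemma cover_fun_act h x : cover_fun (act h x) = act h (cover_fun x).
Proof.
rewrite /cover_fun [RHS](raddf_sum (pack_additive (act_subr (fgmod_graded M) h))).
by apply: eq_bigr => l _; rewrite ffunE (act_mul (fgmod_graded M)).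
Qed.

Lemma cover_fun_homog i x : mhomog i x -> mhomog i (cover_fun x).
Proof.
move=> xi; apply: (mhomog_sum (fgmod_graded M)) => l _.
by rewrite -[i](subrK (d l)); apply: (mhomog_act (fgmod_graded M)); first exact: xi.
Qed.

Definition cover := mkghom cover_funB cover_fun_act cover_fun_homog.

End Cover.

Theorem proposition2 (n : nat) (M : fgmod n) (hproj : projective M)
    (hind : indecomposable M) :
  exists (a : matching n) (m : int), isomorphic M (shift m (proj a)).
Proof.
have gM := fgmod_graded M.
have [k [d [g [gh gP]]]] := homogeneous_generators gM (fgmod_fg M).
have cover_epi : epimorphism (cover gh : ghom (freemod n d) M).
  apply: surjective_epi => x; have [h ->] := gP x; exists [ffun l => h l].
  by apply: eq_bigr => l _; rewrite ffunE.
(* Lifting the identity through the free cover embeds [M] in the free module by [s]; the [co p] are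
   the integer coordinates of this embedding. *)
have [s sK] := hproj _ _ _ (idghom M) cover_epi.
pose co (p : 'I_k * basis n) (x : M) : int := (s x : {ffun 'I_k -> H n}) p.1 p.2.
pose dg (p : 'I_k * basis n) := hdeg p.2 + d p.1.
have coB p : GRing.zmod_morphism (co p) by move=> x y; rewrite /co raddfB !ffunE.
have [x0 x0N] : exists x0 : M, x0 <> 0.
  by apply: not_all_ex_not => z; case: hind => + _; apply.
have ex_co : exists p, exists x, co p x != 0.
  apply: NNPP => no; apply: x0N; rewrite -[x0]sK (_ : s x0 = 0) ?raddf0 //.
  apply/ffunP => l; apply/ffunP => u; rewrite !ffunE; apply/eqP/negPn/negP => nz.
  by apply: no; exists (l, u), x0.
have [[l u] [nz pmin]] := exists_minimal dg ex_co.
have [c [c0 [cdvd [x1 x1c]]]] := divide_by_gcd (coB (l, u)) nz.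
(* The ring acts from the left, so the idempotent that fixes the coordinate [u] is that of the first
   index of its block. *)
pose a := (tag u).1; pose m := dg (l, u).
pose lam (x : M) : int := (co (l, u) x %/ c)%Z.
have lamE x : co (l, u) x = lam x * c by rewrite divzK.
have lamB : GRing.zmod_morphism (lam : M -> simplemod a m).
  by move=> x y; apply: (mulIf c0); rewrite mulrBl -!lamE coB.
(* By minimality, the coordinates in slot [l] of degree below that of [u] vanish on [M], as
   [H_mul_lowest] requires. *)
have lam_act h x : lam (act h x) = act h (lam x : simplemod a m).
  apply: (mulIf c0); rewrite /= -mulrA -!lamE /co ghom_act ffunE H_mul_lowest // => v vu.
  apply/eqP/negPn/negP => nzv; have := pmin (l, v) (ex_intro _ x nzv).
  by rewrite /dg /= lerD2r leNgt vu.
have lam_homog i (x : M) : mhomog i x -> mhomog i (lam x : simplemod a m).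
  move=> /(ghom_homog s) /(_ l u) xi nzl; apply/eqP.
  rewrite eq_sym /m /dg /= -subr_eq eq_sym; apply/eqP/xi.
  by rewrite -[(s x : {ffun _ -> H n}) l u]/(co (l, u) x) lamE mulf_neq0.
have thB : GRing.zmod_morphism
    (fun x : projmod a m => proj_val x (unit_index a) : simplemod a m).
  by move=> x y; rewrite /= ffunE ffunE.
have th_act h (x : projmod a m) : proj_val (act h x) (unit_index a) =
    act h (proj_val x (unit_index a) : simplemod a m) by exact: mul_unit_coef.
have th_homog i (x : projmod a m) : mhomog i x ->
    mhomog i (proj_val x (unit_index a) : simplemod a m).
  by move=> /unit_coef_homog xi /xi/eqP; rewrite subr_eq0 => /eqP.
pose th : ghom (projmod a m) (simplemod a m) := mkghom thB th_act th_homog.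
have th_epi : epimorphism th.
  apply: surjective_epi => z; exists (ProjCar (idem_proj a) *~ z).
  rewrite raddfMz /= idemE eqxx.
  by rewrite (_ : _ *~ z = 1%:Z *~ z :> int) // mulrzz mul1r.
have [psi psiE] := hproj _ _ _ (mkghom lamB lam_act lam_homog) th_epi.
(* [x1] need not be homogeneous; its part of degree [m] is the only one that [lam] sees. *)
have [y [ym lamy]] : exists y : M, mhomog m y /\ lam y = 1.
  have [r [f [fh x1E]]] := mhomog_span gM x1.
  exists (\sum_(i <- r | i == m) f i); split.
    by apply: (mhomog_sum gM) => i /eqP ->.
  have lam1 : lam x1 = 1 by apply: (mulIf c0); rewrite -lamE x1c mul1r.
  rewrite -lam1 x1E [LHS](raddf_sum (pack_additive lamB)) [RHS](raddf_sum (pack_additive lamB)).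
  rewrite [RHS](bigID (fun i => i == m)) /= [X in _ + X]big1 ?addr0 // => i im.
  by apply: contraNeq im => /(lam_homog _ _ (fh i)) ->.
(* Degree [m] in P_a{m} is degree 0 in P_a, where only multiples of 1_a live; the multiple is th
   (psi y) = lam y = 1. *)
have psiy : proj_val (psi y) = idem a.
  have : th (psi y) = 1 by rewrite psiE.
  rewrite /= => y1.
  have y0 : H_homog 0 (proj_val (psi y)).
    by have := ghom_homog psi ym; rewrite /= subrr.
  by rewrite (H_homog0_idem (proj_valP _) y0) y1.
have phB : GRing.zmod_morphism (fun x : projmod a m => act (proj_val x) y).
  by move=> x x'; exact: (act_subl gM).
have ph_act h (x : projmod a m) : act (proj_val (act h x)) y = act h (act (proj_val x) y).
  exact: (act_mul gM).
have ph_homog i (x : projmod a m) : mhomog i x -> mhomog i (act (proj_val x) y).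
  by move=> xi; rewrite -[i](subrK m); apply: (mhomog_act gM).
exists a, m; apply: (@retract_of_indecomposable _ M (projmod a m) psi
  (mkghom phB ph_act ph_homog)) => // [x|P0].
  apply: proj_val_inj; rewrite /= ghom_act /= psiy H_mul_idem //; exact: proj_valP.
have := congr1 (fun x : proj_car a => proj_val x (unit_index a)) (P0 (ProjCar (idem_proj a))).
by rewrite /= idemE eqxx ffunE.
Qed.
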